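(* The map ${}'\epsilon:\mathcal{X}_{N-2}\to E_N$ is a bijection.
   Context: Fix $N\in\{3,5,7,\dots\}$ and let $F=\mathbb{Z}/2\mathbb{Z}$. For $i\le j$ in $\mathbb{Z}$ let $[i,j]=\{h\in\mathbb{Z};i\le h\le j\}$, and let $S_N=[1,N]$. The set of all subsets of $S_N$ is an $F$-vector space with sum $X+X'=(X\cup X')-(X\cap X')$; let $E_N$ be the $F$-subspace of subsets of even cardinality, and ${}^2E_N$ the set of $2$-element subsets. A subset $\{i,j\}\in{}^2E_N$ is written $ij$ if either $i<j$ and $j-i$ is odd, or $i>j$ and $i-j$ is even. Let $\mathcal{P}_N$ be the set of unordered collections $B=\{X_1,\dots,X_k\}$ ($k\ge0$) of elements of ${}^2E_N$ that are pairwise disjoint; let $\mathrm{supp}(B)=\bigcup_{\{i,j\}\in B}\{i,j\}$, $B^0=\{\{i,j\}\in B; i-j \text{ even}\}$, $B^1=\{\{i,j\}\in B; i-j\text{ odd}\}$. A subset $X\subset S_N$ is $0$-covered (resp. $1$-covered) by $B^1$ if there exist $a_1b_1,\dots,a_sb_s\in B^1$ with $X=[a_1,b_1]\sqcup\dots\sqcup[a_s,b_s]$ (resp. $X=[a_1,b_1]\sqcup\dots\sqcup[a_s,b_s]\sqcup\{u\}$ for some $u$). Let ${}^*\mathcal{P}_N$ be the set of $B\in\mathcal{P}_N$ such that: for every $ij\in B^1$, $[i+1,j-1]$ is $0$-covered by $B^1$; and there is a (necessarily unique) sequence $(i_1,\dots,i_{2s})$ in $S_N$, $s=|B^0|$,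 with $B^0=\{i_{2s}i_1,i_{2s-1}i_2,\dots,i_{s+1}i_s\}$ such that, if $s\ge1$, each of $[i_1+1,i_2-1],\dots,[i_{s-1}+1,i_s-1],[i_{s+1}+1,i_{s+2}-1],\dots,[i_{2s-1}+1,i_{2s}-1]$ is $0$-covered by $B^1$. Let $\mathcal{X}_{N-2}^+$ be the set of $B\in{}^*\mathcal{P}_N$ such that $N\notin\mathrm{supp}(B)$ and either $s=0$, or $s$ is odd and one of: (i) $[1,i_1-1]$ is $1$-covered and $[i_{2s}+1,N-1]$ is $0$-covered by $B^1$; (ii) $[1,i_1-1]$ is $0$-covered and $[i_{2s}+1,N-1]$ is $1$-covered by $B^1$. Let $\mathcal{X}_{N-2}^-$ be the set of $B\in{}^*\mathcal{P}_N$ such that either $s=0$ or ($s\ge1$ and $[1,i_1-1]$, $[i_{2s}+1,N]$ are $0$-covered by $B^1$), and moreover $\{i,N\}\in B$ for some even $i$ if $s$ is even, for some odd $i$ if $s$ is odd. Let $\mathcal{X}_{N-2}=\mathcal{X}_{N-2}^+\sqcup\mathcal{X}_{N-2}^-$. For $B\in\mathcal{X}_{N-2}^+$ with $s$ odd, let $u_B$ be the unique $u\in[1,i_1-1]$ with $[1,u-1],[u+1,i_1-1]$ $0$-covered by $B^1$ in case (i) (then $u_B$ is odd), resp. the unique $u\in[i_{2s}+1,N-1]$ with $[i_{2s}+1,u-1],[u+1,N-1]$ $0$-covered by $B^1$ in case (ii) (then $u_B$ is even). For $ij\in{}^2E_N$ set $[[ij]]=[i,j]$ if $i<j$, $j-i$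 odd, and $[[ij]]=[i,N]\cup[1,j]$ if $i>j$, $i-j$ even. Define ${}'\epsilon(B)\in E_N$ (sums in $E_N$) by: ${}'\epsilon(B)=\sum_{ij\in B}[[ij]]$ if $B\in\mathcal{X}_{N-2}^-$ or ($B\in\mathcal{X}_{N-2}^+$, $|B^0|=0$); ${}'\epsilon(B)=\sum_{ij\in B}[[ij]]+[u_B,N]$ if $B\in\mathcal{X}_{N-2}^+$, $|B^0|$ odd, $u_B$ even; ${}'\epsilon(B)=\sum_{ij\in B}[[ij]]+[N,N]+[1,u_B]$ if $B\in\mathcal{X}_{N-2}^+$, $|B^0|$ odd, $u_B$ odd. *)

(* Defs.v *)
(* Points of S_N = [1,N] are represented by the elements
   1..N of the ordinal type 'I_N.+1 (the element 0 is never used: all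
   subsets considered are required to lie in S_N). *)
From mathcomp Require Import all_boot all_order.
Set Implicit Arguments.
Unset Strict Implicit.
Unset Printing Implicit Defensive.

Section Defs.
Variable N : nat.
Local Notation T := 'I_N.+1.

Definition SN : {set T} := [set i : T | 0 < i].
Definition itv (i j : nat) : {set T} := [set h : T | i <= h <= j].
Definition EN (A : {set T}) : bool := (A \subset SN) && ~~ odd #|A|.
(* sum in the F_2-vector space of subsets: symmetric difference *)
Definition symd (A B : {set T}) : {set T} := (A :\: B) :|: (B :\: A).

Definition lo (P : {set T}) : nat := \big[minn/N.+1]_(x in P) (x : nat).
Definition hi (P : {set T}) : nat := \max_(x in P) (x : nat).

Definition is2 (P : {set T}) : bool := (P \subset SN) && (#|P| == 2).
Definition matching (B : {set {set T}}) : bool :=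
  [forall P in B, is2 P] &&
  [forall P in B, forall Q in B, (P != Q) ==> [disjoint P & Q]].

Definition supp (B : {set {set T}}) : {set T} := \bigcup_(P in B) P.
Definition B0 (B : {set {set T}}) : {set {set T}} :=
  [set P in B | ~~ odd (hi P - lo P)].
Definition B1 (B : {set {set T}}) : {set {set T}} :=
  [set P in B | odd (hi P - lo P)].

Definition seg (P : {set T}) : {set T} := itv (lo P) (hi P).

Definition disj_segs (C : {set {set T}}) : bool :=
  [forall P in C, forall Q in C, (P != Q) ==> [disjoint seg P & seg Q]].

Definition cov0 (B : {set {set T}}) (X : {set T}) : bool :=
  [exists C : {set {set T}},
     [&& C \subset B1 B, disj_segs C & X == \bigcup_(P in C) seg P]].

Definition cov1 (B : {set {set T}}) (X : {set T}) : bool :=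
  [exists u : T, exists C : {set {set T}},
     [&& C \subset B1 B, disj_segs C, u \notin \bigcup_(P in C) seg P &
         X == (\bigcup_(P in C) seg P) :|: [set u]]].

(* B in *P_N.  The sequence i_1,...,i_{2s} is taken strictly increasing; it is indexed from 0 here: sq = [:: i_1; ...; i_{2s}]. *)
Definition starP (B : {set {set T}}) : Prop :=
  [/\ matching B,
      (forall P, P \in B1 B -> cov0 B (itv (lo P).+1 (hi P).-1)) &
      exists sq : seq nat,
        let s := #|B0 B| in
        [/\ size sq = (2 * s)%N, sorted ltn sq,
            all (fun i => 1 <= i <= N) sq,
            (forall P, P \in B0 B <->
               exists2 k, k < s &
                 P = [set x : T | ((x : nat) == nth 0 sq (2 * s - 1 - k))
                                  || ((x : nat) == nth 0 sq k)]) &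
            (forall k, k.+1 < 2 * s -> k.+1 != s ->
               cov0 B (itv (nth 0 sq k).+1 (nth 0 sq k.+1).-1))]].

Definition i1 (B : {set {set T}}) : nat := lo (supp (B0 B)).
Definition i2s (B : {set {set T}}) : nat := hi (supp (B0 B)).

Definition caseI (B : {set {set T}}) : bool :=
  cov1 B (itv 1 (i1 B).-1) && cov0 B (itv (i2s B).+1 N.-1).
Definition caseII (B : {set {set T}}) : bool :=
  cov0 B (itv 1 (i1 B).-1) && cov1 B (itv (i2s B).+1 N.-1).

Definition Nmax : T := ord_max.

Definition Xplus (B : {set {set T}}) : Prop :=
  [/\ starP B, Nmax \notin supp B &
      (#|B0 B| = 0 \/ (odd #|B0 B| /\ (caseI B \/ caseII B)))].

Definition Xminus (B : {set {set T}}) : Prop :=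
  [/\ starP B,
      (#|B0 B| = 0 \/
       (1 <= #|B0 B| /\ cov0 B (itv 1 (i1 B).-1) /\ cov0 B (itv (i2s B).+1 N))) &
      exists i : T, [set i; Nmax] \in B /\ odd i = odd #|B0 B| ].

Definition inX (B : {set {set T}}) : Prop := Xplus B \/ Xminus B.

Definition uB (B : {set {set T}}) : nat :=
  if caseI B then
    odflt 0 (omap (fun u : T => u : nat)
      [pick u : T | [&& u \in itv 1 (i1 B).-1, cov0 B (itv 1 (u : nat).-1)
                      & cov0 B (itv (u : nat).+1 (i1 B).-1)]])
  else
    odflt 0 (omap (fun u : T => u : nat)
      [pick u : T | [&& u \in itv (i2s B).+1 N.-1,
                      cov0 B (itv (i2s B).+1 (u : nat).-1)
                      & cov0 B (itv (u : nat).+1 N.-1)]]).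

Definition bra (P : {set T}) : {set T} :=
  if odd (hi P - lo P) then itv (lo P) (hi P)
  else itv (hi P) N :|: itv 1 (lo P).           (* ij, i>j, i-j even *)

Definition eps_base (B : {set {set T}}) : {set T} :=
  \big[symd/set0]_(P in B) bra P.

(* 'epsilon(B).  On X_{N-2}, B is in X^+ iff N is not in supp(B). *)
Definition eps' (B : {set {set T}}) : {set T} :=
  if (Nmax \notin supp B) && odd #|B0 B| then
    (if ~~ odd (uB B) then symd (eps_base B) (itv (uB B) N)
     else symd (symd (eps_base B) (itv N N)) (itv 1 (uB B)))
  else eps_base B.

End Defs.

(* Main.v *)
(** Place the points 1..N on a circle, so that [[ij]] is a clockwise arc with an
    even number of points, and add to each B in X^+ with |B^0| odd the pair
    {u_B, N}, whose arc is the correction term of 'epsilon(B).  This identifies X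
    with the good sets C: sets of disjoint pairs such that every point of an arc of C belongs
    to a pair of C whose arc is contained in it; the added pair is recognised as
    the pair {i,N} for which i and |C^0| have different parities.

    For such a C let h(k) be the number of arcs over the gap between k and k+1.
    A point x lies in max(h(x-1),h(x)) arcs; h changes by +1 or -1 at the points
    of supp(C), and vanishes on both sides of the others.  Hence
    z(k) = (-1)^(h(k)+k) (2h(k)+1) moves by +2 or -2 at x, as prescribed by the parity
    of x and by whether x is in the sum A of the arcs, and z(N) = -z(0) as N is odd.
    So A determines z, h and C.  Conversely the walk z attached to a subset A
    satisfies z(0) = 1 mod 4 exactly when |A| is even, and h = (|z|-1)/2 is then the
    height function of the pairs joining each ascent of h to the matching descent. *)
From HB Require Import structures.
Require Import Defs.
From mathcomp Require Import all_boot all_order all_algebra zify.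
Set Implicit Arguments.
Unset Strict Implicit.
Unset Printing Implicit Defensive.

(* [lia] treats each boolean hypothesis as a variable to split on; hypotheses
   about sets are useless to it and slow it down considerably. *)
Ltac slia :=
  repeat match goal with
  | H : forall _, _ |- _ => clear H
  | H : is_true (in_mem _ _) |- _ => clear H
  | H : is_true (~~ (in_mem _ _)) |- _ => clear H
  | H : is_true (matching _) |- _ => clear H
  | H : is_true (disj_segs _) |- _ => clear H
  | H : is_true (is2 _) |- _ => clear H
  | H : is_true (subset _ _) |- _ => clear H
  | H : is_true (sorted _ _) |- _ => clear H
  | H : is_true (uniq _) |- _ => clear H
  | H : is_true (all _ _) |- _ => clear H
  | H : is_true (~~ (@eq_op _ ?a _)) |- _ =>
      tryif (let A := type of a in unify A nat) then fail else clear H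
  | H : _ = _ :> {set _} |- _ => clear H
  end; lia.

(** * Height functions *)

(** For given h(x-1), the parity of max(h(x-1),h(x)) tells whether h goes up or down at x, and an
    attempt to go down from 0 leaves h at 0: this is a walk reflected at 0. The signed numbers 2h+1
    unfold the reflection. Since h(k)+k keeps its parity at a step of +1 or -1 and changes it at a
    flat step, a flat step becomes the crossing from 1 to -1 or back. The circle closes up to a sign
    because N is odd, and z(N) = -z(0) forces z(0) to be minus half the total displacement. With a
    plus sign the initial height would stay undetermined. The parity test for the added pair comes
    from N - u_B being even exactly when u_B is odd: starting from |B^0| odd, adding {u_B,N} leaves
    |C^0| odd if u_B is even and makes it even if u_B is odd. In X^- the parities of i and |B^0|
    agree instead. *)

Definition height_step (h : nat -> nat) (x : nat) : Prop :=
  h x.+1 = (h x).+1 \/ h x = (h x.+1).+1 \/ (h x = 0 /\ h x.+1 = 0).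

(** Step [x] takes place at the point [x + 1], between the gaps [x] and [x + 1]; hence the shift in
    the argument of [a]. *)
Definition height_for (N : nat) (a : nat -> bool) (h : nat -> nat) : Prop :=
  h N = h 0 /\
  forall x, x < N -> height_step h x /\ a x.+1 = odd (maxn (h x) (h x.+1)).

Definition signed_height (h : nat -> nat) (k : nat) : int :=
  (if odd (h k + k) then - (h k).*2.+1%:Z else (h k).*2.+1%:Z)%R.

(** The increment no longer involves [h]: two height functions for the same [a] therefore have
    signed heights with a constant difference. *)
Lemma signed_heightS N a h x : height_for N a h -> x < N ->
  signed_height h x.+1 =
  (signed_height h x + (if odd (a x.+1 + x) then 2 else - 2))%R.
Proof.
case=> _ /[apply] -[hst ->]; rewrite /signed_height.
case: hst => [->|[->|[-> ->]]].
- rewrite (maxn_idPr (leqnSn _)) !oddD /=; case: (odd _); case: (odd _) => /=; lia.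
- rewrite (maxn_idPl (leqnSn _)) !oddD /=; case: (odd _); case: (odd _) => /=; lia.
by rewrite maxnn /=; case: (odd x) => /=; lia.
Qed.

Lemma height_uniq N a h h' : odd N -> height_for N a h -> height_for N a h' ->
  forall k, k <= N -> h k = h' k.
Proof.
move=> oN hh hh'.
have dz k : k <= N -> (signed_height h k - signed_height h' k =
    signed_height h 0 - signed_height h' 0)%R.
  elim: k => // k IH lekN; rewrite (signed_heightS hh) // (signed_heightS hh') //.
  by rewrite -IH 1?ltnW //; lia.
have zN g : height_for N a g -> signed_height g N = (- signed_height g 0)%R.
  case=> gN _; rewrite /signed_height gN !oddD oN /=.
  by case: (odd _) => /=; lia.
have absz g j : (g j).*2.+1 = `|signed_height g j|%N.
  by rewrite /signed_height; case: ifP; lia.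
(* Both signed heights change sign between 0 and N, so their constant difference is its own opposite
   and vanishes. *)
have := dz N (leqnn N); rewrite !zN // => d0 k /dz dk.
by have := absz h k; have := absz h' k; lia.
Qed.

(** Half of the signed height up to an additive constant, which is chosen once the final value is
    known. *)
Fixpoint walk (a : nat -> bool) (k : nat) : int :=
  if k is x.+1 then (walk a x + (if odd (a x.+1 + x) then 1 else - 1))%R
  else 0%R.

Lemma height_exists N (a : nat -> bool) : odd N -> ~~ odd (\sum_(1 <= x < N.+1) a x) ->
  exists h, height_for N a h.
Proof.
move=> oN ea.
(* With [a] zero the walk alternates between 0 and -1; each point where [a] is true reverses one
   step, which adds 2 modulo 4. *)
have wmod k : (exists m : int,
    walk a k = (\sum_(1 <= x < k.+1) a x).*2%:Z - (nat_of_bool (odd k))%:Z + 4 * m)%R.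
  elim: k => [|k [m IH]]; first by exists 0%R; rewrite big_nil /=; lia.
  rewrite big_nat_recr //= IH.
  set s := \sum_(_ <= _ < _) _.
  case: (a k.+1) => /=; case: (odd k) => /=.
  - by exists (m - 1)%R; lia.
  - by exists m; lia.
  - by exists m; lia.
  by exists m; lia.
(* The constant is forced by z(N) = -z(0). *)
pose z k : int := (2 * walk a k - walk a N)%R.
(* Evenness of the sum enters here: it makes [walk a N] equal to -1 modulo 4. *)
have zmod k : k <= N -> (exists m : int, z k = 1 + (odd k).*2%:Z + 4 * m)%R.
  move=> _; rewrite /z; have [m ->] := wmod k; have [m' ->] := wmod N.
  rewrite oN. 
  exists ((\sum_(1 <= x < k.+1) a x)%:Z - (odd k)%:Z + 2 * m
     - ((\sum_(1 <= x < N.+1) a x)./2)%:Z - m')%R.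
  move: ea; set s := (\sum_(1 <= x < k.+1) _); set S := (\sum_(1 <= x < N.+1) _).
  move=> eS; have := odd_double_half S; rewrite (negbTE eS) => eS2.
  rewrite -[in LHS]eS2 add0n; case: (odd k) => /=; clearbody s; clear; move: (S./2) m m'; lia.
have zS k : z k.+1 = (z k + (if odd (a k.+1 + k) then 2 else - 2))%R.
  by rewrite /z /=; case: odd; lia.
exists (fun k => (`|z k|%N.-1)./2); split.
  have zN : z N = (- z 0)%R by rewrite /z /=; lia.
  by rewrite /= zN abszN.
(* The residue modulo 4 makes [z] positive exactly when height and position have the same parity, so
   each step of [z] becomes the required step of the height. *)
move=> x ltxN; have [m zx] := zmod x (ltnW ltxN).
rewrite /height_step zS zx oddD; case: (a x.+1); case: (odd x) => /=; clear; split; lia.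
Qed.

(** * Arcs of a pair *)

Section Sums.
Variable N : nat.
Local Notation T := 'I_N.+1.
Implicit Types (A : {set T}) (C : {set {set T}}).

Lemma in_symd A A' x : (x \in symd A A') = (x \in A) (+) (x \in A').
Proof. by rewrite !inE; case: (x \in A); case: (x \in A'). Qed.

Lemma symdA : associative (@symd N).
Proof. by move=> A B D; apply/setP => x; rewrite !in_symd addbA. Qed.

Lemma symdC : commutative (@symd N).
Proof. by move=> A B; apply/setP => x; rewrite !in_symd addbC. Qed.

Lemma symd0s : left_id set0 (@symd N).
Proof. by move=> A; apply/setP => x; rewrite in_symd inE. Qed.

HB.instance Definition _ :=
  Monoid.isComLaw.Build {set T} set0 (@symd N) symdA symdC symd0s.

Lemma in_big_symd C (F : {set T} -> {set T}) x :
  (x \in \big[@symd N/set0]_(P in C) F P) = odd #|[set P in C | x \in F P]|.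
Proof.
rewrite -sum1_card (big_morph (fun A => x \in A) (fun A B => in_symd A B x) (in_set0 x)).
rewrite (big_morph odd oddD (erefl : odd 0 = false)).
under [RHS]eq_bigl => P do rewrite !inE.
by rewrite [RHS]big_mkcondr; apply: eq_bigr => P _; case: (x \in F P).
Qed.

Lemma odd_card_symd A A' : odd #|symd A A'| = odd #|A| (+) odd #|A'|.
Proof.
have dis : [disjoint A :\: A' & A' :\: A].
  by rewrite -setI_eq0; apply/eqP/setP => x; rewrite !inE; case: (x \in A); case: (x \in A').
rewrite /symd cardsU disjoint_setI0 // cards0 subn0 oddD !cardsD.
rewrite !oddB ?subset_leq_card ?subsetIl // (setIC A' A).
by case: (odd _); case: (odd _); case: (odd _).
Qed.

Lemma odd_card_big_symd C (F : {set T} -> {set T}) :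
  (forall P, P \in C -> ~~ odd #|F P|) -> ~~ odd #|\big[@symd N/set0]_(P in C) F P|.
Proof.
move=> ev; elim/big_rec: _ => [|P A PC]; first by rewrite cards0.
by rewrite odd_card_symd (negbTE (ev P PC)).
Qed.

End Sums.

(** * Ends, gaps and inclusion of arcs *)

Section Arcs.
Variable N : nat.
Local Notation T := 'I_N.+1.
Implicit Types (P Q A X : {set T}) (B C : {set {set T}}) (x y : T).

Lemma lo_le P x : x \in P -> lo P <= x.
Proof.
move=> xP; rewrite /lo; have := mem_index_enum x.
elim: (index_enum _) => //= y s IH; rewrite inE big_cons.
case/predU1P => [<-|/IH le]; first by rewrite xP geq_minl.
by case: ifP => // _; apply: leq_trans (geq_minr _ _) le.
Qed.

Lemma hi_ge P x : x \in P -> x <= hi P.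
Proof. by move=> xP; rewrite /hi (bigD1 x) //= leq_maxl. Qed.

Lemma lo_eq P x : x \in P -> (forall y, y \in P -> x <= y) -> lo P = x.
Proof.
move=> xP minx; apply/eqP; rewrite eqn_leq lo_le //=.
rewrite /lo; elim/big_ind: _ => [|m n|y /minx //]; first exact: ltnW.
by rewrite leq_min => -> ->.
Qed.

Lemma hi_eq P x : x \in P -> (forall y, y \in P -> y <= x) -> hi P = x.
Proof.
move=> xP maxx; apply/eqP; rewrite eqn_leq hi_ge // andbT.
by apply/bigmax_leqP => y /maxx.
Qed.

(** The ends are natural numbers rather than points, and the body has the form of the pairs listed
    in [starP]. *)
Definition chord (a b : nat) : {set T} := [set x : T | (x == a :> nat) || (x == b :> nat)].

Lemma chordC a b : chord a b = chord b a.
Proof. by apply/setP => x; rewrite !inE orbC. Qed.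

Section Pair.
Variables (a b : nat).
Hypotheses (a_gt0 : 0 < a) (lt_ab : a < b) (leb : b <= N).

Let apt : T := inord a.
Let bpt : T := inord b.
Let aE : apt = a :> nat. Proof. by rewrite inordK //; lia. Qed.
Let bE : bpt = b :> nat. Proof. by rewrite inordK //; lia. Qed.

Lemma lo_chord : lo (chord a b) = a.
Proof.
rewrite -aE; apply: lo_eq => [|y]; rewrite inE aE ?eqxx //.
by case/orP => /eqP ->; lia.
Qed.

Lemma hi_chord : hi (chord a b) = b.
Proof.
rewrite -bE; apply: hi_eq => [|y]; rewrite inE bE ?eqxx ?orbT //.
by case/orP => /eqP ->; lia.
Qed.

Lemma is2_chord : is2 (chord a b).
Proof.
have -> : chord a b = [set apt; bpt].
  by apply/setP => x; rewrite !inE -!val_eqE /= aE bE.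
rewrite /is2 cards2 -val_eqE /= aE bE (ltn_eqF lt_ab) andbT.
by apply/subsetP => x; rewrite !inE => /orP[] /eqP ->; rewrite ?aE ?bE; lia.
Qed.

End Pair.

Lemma is2P P : is2 P ->
  [/\ 0 < lo P, lo P < hi P, hi P <= N & P = chord (lo P) (hi P)].
Proof.
case/andP=> PS /cards2P[x [y [xy PE]]].
wlog ltxy : x y xy PE / x < y.
  move=> wl; have [ltxy|ltyx|eqxy] := ltngtP x y; first exact: (wl x y).
    by apply: (wl y x); rewrite // 1?eq_sym // setUC.
  by case/eqP: xy; apply: val_inj.
have x0 : 0 < x by have := subsetP PS x; rewrite PE !inE eqxx; apply.
have leyN : y <= N by rewrite -ltnS.
have {PE}-> : P = chord x y by rewrite PE; apply/setP => z; rewrite !inE -!val_eqE.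
by rewrite lo_chord ?hi_chord //; split.
Qed.

Lemma mem_is2 P x : is2 P -> (x \in P) = (x == lo P :> nat) || (x == hi P :> nat).
Proof. by case/is2P=> _ _ _ {1}->; rewrite inE. Qed.

Lemma is2_inj P Q : is2 P -> is2 Q -> lo P = lo Q -> hi P = hi Q -> P = Q.
Proof. by case/is2P=> _ _ _ PE /is2P[_ _ _ QE] el eh; rewrite PE QE el eh. Qed.

(* [bra P] runs clockwise from the point [op P] to the point [cl P]; it wraps around
   the point [N] unless [line P]. *)
Definition line P : bool := odd (hi P - lo P).
Definition op P : nat := if line P then lo P else hi P.
Definition cl P : nat := if line P then hi P else lo P.

(* The gap [k] lies between the points [k] and [k + 1] of the circle; the gaps
   [0] and [N] are the same. *)
Definition over P (k : nat) : bool :=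
  if line P then lo P <= k < hi P else (k < lo P) || (hi P <= k).

Lemma in_bra P x : is2 P -> 0 < x ->
  (x \in bra P) = if line P then lo P <= x <= hi P else (x <= lo P) || (hi P <= x).
Proof.
move=> _ x0; rewrite /bra -/(line P); case: ifP => _; rewrite !inE //.
by have := ltn_ord x; lia.
Qed.

Lemma bra_gt0 P x : is2 P -> x \in bra P -> 0 < x.
Proof.
case/is2P=> lo0 ltlh hN _; rewrite /bra; case: ifP => _; rewrite !inE; lia.
Qed.

Lemma odd_card_itv i j : 0 < i -> j <= N -> i <= j -> odd #|itv N i j| = ~~ odd (j - i).
Proof.
move=> i0 jN lij.
have -> : #|itv N i j| = (j - i).+1.
  transitivity (\sum_(0 <= k < N.+1) (i <= k <= j)).
    rewrite big_mkord -sum1_card big_mkcond.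
    by apply: eq_bigr => k _; rewrite inE; case: ifP.
  rewrite (big_cat_nat _ (n := i)) //=; last by lia.
  rewrite (@big_cat_nat _ _ _ j.+1 i) //=; [|lia..].
  rewrite big_nat big1 ?add0n; last by move=> k kk; lia.
  rewrite [X in _ + X]big_nat [X in _ + X]big1 ?addn0; last by move=> k kk; lia.
  rewrite (eq_big_nat _ _ (F2 := fun=> 1)); last by move=> k kk; lia.
  by rewrite sum_nat_const_nat muln1; lia.
by [].
Qed.

Definition subarc Q P : bool :=
  if line Q then
    if line P then (lo P <= lo Q) && (hi Q <= hi P)
    else (hi Q <= lo P) || (hi P <= lo Q)
  else [&& ~~ line P, lo Q <= lo P & hi P <= hi Q].

Definition good C : Prop :=
  matching C /\ forall P x, P \in C -> x \in bra P ->
    exists Q, [/\ Q \in C, x \in Q & bra Q \subset bra P].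

Lemma matching_is2 C P : matching C -> P \in C -> is2 P.
Proof. by case/andP=> /forall_inP/(_ P). Qed.

Lemma matching_uniq C P Q x : matching C -> P \in C -> Q \in C -> x \in P -> x \in Q -> P = Q.
Proof.
case/andP=> _ /forall_inP m PC QC xP xQ; have /forall_inP/(_ _ QC)/implyP := m _ PC.
by case: eqVneq => // _ /(_ isT) /disjointFr /(_ xP); rewrite xQ.
Qed.

Lemma matchingI C : (forall P, P \in C -> is2 P) ->
  (forall P Q x, P \in C -> Q \in C -> x \in P -> x \in Q -> P = Q) -> matching C.
Proof.
move=> m2 mu; apply/andP; split; first by apply/forall_inP.
apply/forall_inP => P PC; apply/forall_inP => Q QC; apply/implyP => nPQ.
rewrite -setI_eq0; apply/eqP/setP => x; rewrite !inE; apply/negP => /andP[xP xQ].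
by case/eqP: nPQ; apply: mu xP xQ.
Qed.

Lemma op_cl_mem P x : is2 P -> (x \in P) = (x == op P :> nat) || (x == cl P :> nat).
Proof. by move=> P2; rewrite mem_is2 // /op /cl; case: line => //; rewrite orbC. Qed.

Lemma op_range P : is2 P -> [/\ 0 < op P, op P <= N, 0 < cl P, cl P <= N & op P != cl P].
Proof. by case/is2P; rewrite /op /cl; case: line; split; lia. Qed.

Lemma over_op P (k : nat) : is2 P -> k.+1 = op P -> ~~ over P k && over P k.+1.
Proof. by case/is2P; rewrite /op /over; case: line; lia. Qed.

Lemma over_cl P (k : nat) : is2 P -> k.+1 = cl P -> over P k && ~~ over P k.+1.
Proof. by case/is2P; rewrite /cl /over; case: line; lia. Qed.

Lemma over_notin P (k : nat) : is2 P -> k.+1 <> op P -> k.+1 <> cl P -> over P k.+1 = over P k.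
Proof. by case/is2P; rewrite /cl /op /over; case: line; lia. Qed.

Lemma bra_over P x : is2 P -> 0 < x -> (x \in bra P) = over P x.-1 || over P x.
Proof.
by move=> P2 x0; rewrite in_bra //; case/is2P: P2; rewrite /over; case: line; lia.
Qed.

Lemma over0N P : is2 P -> over P N = over P 0.
Proof. by case/is2P; rewrite /over; case: line; lia. Qed.

Hypothesis oN : odd N.

Lemma odd_card_bra P : is2 P -> ~~ odd #|bra P|.
Proof.
case/is2P=> lo0 lth hN _; rewrite /bra; case: ifP => par.
  by rewrite odd_card_itv // ?par //; lia.
rewrite cardsU disjoint_setI0 ?cards0 ?subn0 ?oddD ?odd_card_itv //; [lia..|].
by rewrite -setI_eq0; apply/eqP/setP => x; rewrite !inE; lia.
Qed.

Lemma bra_subset Q P : is2 Q -> is2 P -> (bra Q \subset bra P) = subarc Q P.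
Proof.
move=> Q2 P2; have [Ql0 Qlh QhN _] := is2P Q2; have [Pl0 Plh PhN _] := is2P P2.
(* Parity leaves room outside each arc: a wrapping arc misses [lo P + 1], and a line misses 1 or N
   because N is odd. *)
have lth : ~~ line P -> (lo P).+1 < hi P by rewrite /line; lia.
have lne : line P -> ~~ ((lo P == 1) && (hi P == N)).
  by rewrite /line; move=> lP; apply/negP => /andP[/eqP p /eqP q]; move: lP; rewrite p q; lia.
apply/subsetP/idP => [sQP|sQP x xQ]; last first.
  have x0 := bra_gt0 Q2 xQ; move: xQ sQP lth; rewrite !in_bra // /subarc.
  by case: (line P); case: (line Q); lia.
have at_ k : 0 < k -> k <= N ->
   (if line Q then lo Q <= k <= hi Q else (k <= lo Q) || (hi Q <= k)) ->
   (if line P then lo P <= k <= hi P else (k <= lo P) || (hi P <= k)).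
  by move=> k0 kN; have := sQP (inord k); rewrite !in_bra ?inordK //.
(* Five test points suffice: the ends of [Q], the points 1 and N, which lie in every wrapping arc,
   and [lo P + 1], which is outside [P] if [P] wraps. *)
rewrite /subarc; have al := at_ (lo Q); have ah := at_ (hi Q).
have a1 := at_ 1; have aN := at_ N; have am := at_ (lo P).+1.
move: al ah a1 aN am lth lne; case: (line P); case: (line Q) => /=; lia.
Qed.

End Arcs.

(** * The height function of a set of pairs *)

Section Heights.
Variable N : nat.
Local Notation T := 'I_N.+1.
Implicit Types (P Q A X : {set T}) (B C : {set {set T}}) (x y : T) (h : nat -> nat).

Definition arc_sum C : {set T} := \big[@symd N/set0]_(P in C) bra P.

Definition covering C (k : nat) : {set {set T}} := [set P in C | over P k].
Definition height C (k : nat) : nat := #|covering C k|.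

(** Parenthesis matching on the circle: [P] joins an ascent of [h] to the first return to the level
    below it. Only [h] is involved, so pairs can be recovered from heights. *)
Definition is_arc h P : bool :=
  (h (op P).-1 == h (cl P)) && [forall k : T, over P k ==> (h (cl P) < h k)].

Lemma is_arcP h P : reflect
  (h (op P).-1 = h (cl P) /\ forall k, k <= N -> over P k -> h (cl P) < h k)
  (is_arc h P).
Proof.
apply: (iffP andP) => -[/eqP e H]; split=> //.
  by move=> k kN; have /forallP/(_ (inord k)) := H; rewrite inordK // => /implyP.
by apply/forallP => k; apply/implyP; apply: H; rewrite -ltnS.
Qed.

Lemma covering_op C P k : matching C -> P \in C -> op P = k.+1 ->
  covering C k.+1 = P |: covering C k /\ P \notin covering C k.
Proof.
move=> mC PC oP; have P2 := matching_is2 mC PC.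
have /andP[nok okS] := over_op P2 (esym oP).
split; last by rewrite inE PC (negbTE nok).
apply/setP => Q; rewrite !inE; have [->|nQP] /= := eqVneq Q P; first by rewrite PC okS.
case QC: (Q \in C) => //=; have Q2 := matching_is2 mC QC.
have [_ leN _ _ _] := op_range P2.
have xP : (inord k.+1 : T) \in P by rewrite op_cl_mem // inordK ?oP ?eqxx // ltnS -oP.
have : (inord k.+1 : T) \notin Q.
  by apply: contra nQP => xQ; rewrite (matching_uniq mC QC PC xQ xP).
rewrite op_cl_mem // inordK ?ltnS -?oP // oP negb_or => /andP[/eqP n1 /eqP n2].
exact: over_notin.
Qed.

Lemma covering_cl C P k : matching C -> P \in C -> cl P = k.+1 ->
  covering C k = P |: covering C k.+1 /\ P \notin covering C k.+1.
Proof.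
move=> mC PC oP; have P2 := matching_is2 mC PC.
have /andP[ok nokS] := over_cl P2 (esym oP).
split; last by rewrite inE PC (negbTE nokS).
apply/setP => Q; rewrite !inE; have [->|nQP] /= := eqVneq Q P; first by rewrite PC ok.
case QC: (Q \in C) => //=; have Q2 := matching_is2 mC QC.
have [_ _ _ leN _] := op_range P2.
have xP : (inord k.+1 : T) \in P by rewrite op_cl_mem // inordK ?oP ?eqxx ?orbT // ltnS -oP.
have : (inord k.+1 : T) \notin Q.
  by apply: contra nQP => xQ; rewrite (matching_uniq mC QC PC xQ xP).
rewrite op_cl_mem // inordK ?ltnS -?oP // oP negb_or => /andP[/eqP n1 /eqP n2].
by rewrite over_notin.
Qed.

(** An arc over a gap beside [x] would contain [x], and goodness would provide a pair through
    [x]. *)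
Lemma covering_unmatched C x : good C -> 0 < x -> (forall P, P \in C -> x \notin P) ->
  covering C x = set0 /\ covering C x.-1 = set0.
Proof.
case=> mC gC x0 un.
suff H (k : nat) : (k = x :> nat \/ k = x.-1) -> covering C k = set0 by split; apply: H;
  [left|right].
move=> kx; apply/setP => P; rewrite !inE; apply/negP => /andP[PC ok].
have xb : x \in bra P.
  by rewrite (bra_over (matching_is2 mC PC)) //; case: kx => <-; rewrite ok ?orbT.
by have [Q [QC xQ _]] := gC P x PC xb; rewrite (negbTE (un Q QC)) in xQ.
Qed.

Lemma bra_cover C x : matching C -> 0 < x ->
  [set P in C | x \in bra P] = covering C x.-1 :|: covering C x.
Proof.
move=> mC x0; apply/setP => P; rewrite !inE; case PC: (P \in C) => //=.
by rewrite (bra_over (matching_is2 mC PC)).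
Qed.

Lemma height_op C P k : matching C -> P \in C -> op P = k.+1 -> height C k.+1 = (height C k).+1.
Proof.
by move=> mC PC /(covering_op mC PC)[e n]; rewrite /height e cardsU1 n.
Qed.

Lemma height_cl C P k : matching C -> P \in C -> cl P = k.+1 -> height C k = (height C k.+1).+1.
Proof.
by move=> mC PC /(covering_cl mC PC)[e n]; rewrite /height e cardsU1 n.
Qed.

Lemma height_unmatched C x : good C -> 0 < x -> (forall P, P \in C -> x \notin P) ->
  height C x = 0 /\ height C x.-1 = 0.
Proof.
by move=> gC x0 /(covering_unmatched gC x0)[e e']; rewrite /height e e' cards0.
Qed.

Lemma matched_cases C k : matching C -> k < N ->
  [\/ exists2 P, P \in C & op P = k.+1, exists2 P, P \in C & cl P = k.+1 |
      forall P, P \in C -> (inord k.+1 : T) \notin P].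
Proof.
move=> mC kN; have kE : (inord k.+1 : T) = k.+1 :> nat by rewrite inordK.
have [/exists_inP[P PC]|/exists_inPn un] := boolP [exists P in C, (inord k.+1 : T) \in P].
  rewrite op_cl_mem ?(matching_is2 mC) // kE => /orP[] /eqP e.
    by constructor 1; exists P.
  by constructor 2; exists P.
by constructor 3.
Qed.

Lemma height_good C : good C -> height_for N (fun k => inord k \in arc_sum C) (height C).
Proof.
move=> gC; have [mC _] := gC; split.
  congr #|pred_of_set _|; apply/setP => P; rewrite !inE.
  by case PC: (P \in C); rewrite //= over0N // (matching_is2 mC).
move=> k kN; have kE : (inord k.+1 : T) = k.+1 :> nat by rewrite inordK.
(* The arcs through the point are those over one of its two gaps. In each case below one of the two
   coverings contains the other, so the union has the larger of the two sizes. *)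
have -> : (inord k.+1 \in arc_sum C) = odd #|covering C k :|: covering C k.+1|.
  by rewrite in_big_symd bra_cover // kE.
case: (matched_cases mC kN) => [[P PC oP]|[P PC cP]|un].
- have [e _] := covering_op mC PC oP; have hS := height_op mC PC oP.
  split; first by left.
  by rewrite e setUCA setUid -e hS (maxn_idPr (leqnSn _)) -hS.
- have [e _] := covering_cl mC PC cP; have hS := height_cl mC PC cP.
  split; first by right; left.
  by rewrite e -setUA setUid -e hS (maxn_idPl (leqnSn _)) -hS.
have x0 : 0 < (inord k.+1 : T) by rewrite kE.
have [e e'] := covering_unmatched gC x0 un; have [h1 h2] := height_unmatched gC x0 un.
rewrite kE /= in e e' h1 h2; split; first by right; right.
by rewrite e e' h1 h2 setUid cards0.
Qed.

(** Both arcs have the same base level. The gap after the closing point of each is at that level,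
    hence not under the other arc. *)
Lemma op_arc_inj h P Q : is2 P -> is2 Q -> is_arc h P -> is_arc h Q ->
  op P = op Q -> P = Q.
Proof.
move=> P2 Q2 /is_arcP[eP aP] /is_arcP[eQ aQ] ePQ.
have [lP0 ltP hP _] := is2P P2; have [lQ0 ltQ hQ _] := is2P Q2.
have c : h (cl P) = h (cl Q) by rewrite -eP -eQ ePQ.
have [_ _ _ clP _] := op_range P2; have [_ _ _ clQ _] := op_range Q2.
have n1 : ~~ over P (cl Q) by apply/negP => /(aP _ clQ); lia.
have n2 : ~~ over Q (cl P) by apply/negP => /(aQ _ clP); lia.
move: n1 n2 ePQ; rewrite /over /op /cl.
case lP: (line P); case lQ: (line Q) => n1 n2 ePQ; try lia; apply: is2_inj => //; lia.
Qed.

Lemma cl_arc_inj h P Q : is2 P -> is2 Q -> is_arc h P -> is_arc h Q ->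
  cl P = cl Q -> P = Q.
Proof.
move=> P2 Q2 /is_arcP[eP aP] /is_arcP[eQ aQ] ePQ.
have [lP0 ltP hP _] := is2P P2; have [lQ0 ltQ hQ _] := is2P Q2.
have c : h (op P).-1 = h (op Q).-1 by rewrite eP eQ ePQ.
have [_ oP _ clP _] := op_range P2; have [_ oQ _ clQ _] := op_range Q2.
have n1 : ~~ over P (op Q).-1 by apply/negP => /(aP _ (leq_trans (leq_pred _) oQ)); lia.
have n2 : ~~ over Q (op P).-1 by apply/negP => /(aQ _ (leq_trans (leq_pred _) oP)); lia.
move: n1 n2 ePQ; rewrite /over /op /cl.
case lP: (line P); case lQ: (line Q) => n1 n2 ePQ; try lia; apply: is2_inj => //; lia.
Qed.

Lemma arc_op_step h P : is2 P -> is_arc h P -> h (op P).-1 < h (op P).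
Proof.
move=> P2 /is_arcP[-> aP]; have [o0 oN' _ _ _] := op_range P2; apply: aP => //.
by have /(over_op P2) := prednK o0; rewrite prednK // => /andP[].
Qed.

Lemma arc_cl_step h P : is2 P -> is_arc h P -> h (cl P) < h (cl P).-1.
Proof.
move=> P2 /is_arcP[_ aP]; have [_ _ c0 cN' _] := op_range P2.
apply: aP; first exact: leq_trans (leq_pred _) cN'.
by have /(over_cl P2) := prednK c0; rewrite prednK // => /andP[].
Qed.

Hypothesis oN : odd N.

Lemma is_arc_good C P : good C -> P \in C -> is_arc (height C) P.
Proof.
move=> gC PC; have [mC nC] := gC; have P2 := matching_is2 mC PC.
have [o0 oN' c0 cN _] := op_range P2.
(* An arc covering the gap next to an end of [P] contains that end, hence all of [P]. *)
have sub Q k (x : T) : x \in P -> Q \in C -> Q != P -> k <= N -> over P k -> x \in bra Q ->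
  over Q k.
  move=> xP QC nQP kN okP xQ; have Q2 := matching_is2 mC QC.
  have [R [RC xR]] := nC _ _ QC xQ.
  rewrite -(matching_uniq mC PC RC xP xR) bra_subset // /subarc.
  have: lo P <> lo Q /\ hi P <> hi Q.
    have oeq (y : T) : y \in P -> y \in Q -> False.
      by move=> yP yQ; case/eqP: nQP; exact: (matching_uniq mC QC PC yQ yP).
    have [l0 llh hN _] := is2P P2.
    have lN : lo P < N.+1 by rewrite ltnS (leq_trans (ltnW llh)).
    split=> e; [apply: (oeq (inord (lo P)))|apply: (oeq (inord (hi P)))];
      by rewrite mem_is2 // inordK // ?e eqxx ?orbT.
  have [l0 llh hN _] := is2P P2; have [l0' llh' hN' _] := is2P Q2.
  move: okP; rewrite /over; clear -l0 llh hN l0' llh' hN' kN.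
  by case: (line P); case: (line Q) => /=; lia.
have kop : (op P).-1.+1 = op P by rewrite prednK.
have kcl : (cl P).-1.+1 = cl P by rewrite prednK.
have opE : (inord (op P) : T) = op P :> nat by rewrite inordK.
have clE : (inord (cl P) : T) = cl P :> nat by rewrite inordK.
have oP : (inord (op P) : T) \in P by rewrite op_cl_mem // opE eqxx.
have cP : (inord (cl P) : T) \in P by rewrite op_cl_mem // clE eqxx orbT.
have /andP[no_op o_op] := over_op P2 kop; rewrite kop in o_op.
have /andP[o_cl no_cl] := over_cl P2 kcl; rewrite kcl in no_cl.
have cov_op k : k <= N -> over P k -> covering C (op P).-1 \subset covering C k :\ P.
  move=> kN ok; apply/subsetP => Q; rewrite !inE => /andP[QC oQ]; rewrite QC /=.
  have nQP : Q != P by apply: contraTneq oQ => ->.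
  rewrite nQP; apply: (sub _ _ _ oP QC nQP kN ok).
  by rewrite bra_over ?opE // ?oQ //; exact: (matching_is2 mC QC).
have cov_cl k : k <= N -> over P k -> covering C (cl P) \subset covering C k :\ P.
  move=> kN ok; apply/subsetP => Q; rewrite !inE => /andP[QC oQ]; rewrite QC /=.
  have nQP : Q != P by apply: contraTneq oQ => ->.
  rewrite nQP; apply: (sub _ _ _ cP QC nQP kN ok).
  by rewrite bra_over ?clE ?oQ ?orbT //; exact: (matching_is2 mC QC).
have cardD k : over P k -> #|covering C k :\ P| = (height C k).-1.
  by move=> ok; rewrite /height (cardsD1 P (covering C k)) inE PC ok.
have ho := height_op mC PC (esym kop); have hc := height_cl mC PC (esym kcl).
rewrite kop in ho; rewrite kcl in hc.
apply/is_arcP; split.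
  (* The inclusions at the last and at the first gap under [P] give the two inequalities between the
     heights outside its ends. *)
  have := subset_leq_card (cov_op (cl P).-1 (leq_trans (leq_pred _) cN) o_cl).
  have := subset_leq_card (cov_cl (op P) oN' o_op).
  rewrite !cardD // -/(height _ _) ho hc /= -/(height _ _); clear; lia.
move=> k kN ok; have := subset_leq_card (cov_cl k kN ok); rewrite cardD // -/(height _ _).
have : 0 < height C k by apply/card_gt0P; exists P; rewrite inE PC.
by clear; lia.
Qed.

(** The sum determines the height, and the height determines each pair: where [C] opens a pair the
    height goes up, so [C'] opens one too, and the arc condition fixes where it closes. *)
Lemma arc_sum_inj C C' : good C -> good C' -> arc_sum C = arc_sum C' -> C = C'.
Proof.
wlog suff sub : C C' / good C -> good C' -> arc_sum C = arc_sum C' -> C \subset C'.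
  by move=> gC gC' e; apply/eqP; rewrite eqEsubset !sub.
move=> gC gC' e; have [mC _] := gC; have [mC' _] := gC'.
have hC := height_good gC; have hC' := height_good gC'; rewrite -e in hC'.
have eh := height_uniq oN hC hC'.
apply/subsetP => P PC; have P2 := matching_is2 mC PC.
have [o0 oN' c0 cN' _] := op_range P2; have aP := is_arc_good gC PC.
have kop : (op P).-1.+1 = op P by rewrite prednK.
have kN : (op P).-1 < N by lia.
have hP : height C' (op P) = (height C' (op P).-1).+1.
  by rewrite -!eh ?(ltnW kN) // -{1}kop (height_op mC PC) // -kop.
have aP' : is_arc (height C') P.
  have/is_arcP[e1 e2] := aP; apply/is_arcP; rewrite -!eh ?(ltnW kN) //; split=> // k lek.
  by rewrite -eh //; apply: e2.
case: (matched_cases mC' kN); rewrite kop.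
- case=> Q QC' oQ; have Q2 := matching_is2 mC' QC'.
  by rewrite (op_arc_inj P2 Q2 aP' (is_arc_good gC' QC')).
- case=> Q QC' cQ; have := @height_cl C' Q (op P).-1 mC' QC'; rewrite kop hP => /(_ cQ);
  clear; lia.
move=> un; have kE : (inord (op P) : T) = op P :> nat by rewrite inordK.
by have [] := height_unmatched gC' _ un; rewrite kE // hP.
Qed.

End Heights.

(** * The pairs of a height function *)

(** The positivity assumption rules out flat steps; at all other steps [h k] and [k] change parity
    together. *)
Lemma height_parity (h : nat -> nat) i j : i <= j ->
  (forall k, i <= k < j -> height_step h k) ->
  (forall k, i <= k < j -> 0 < h k \/ 0 < h k.+1) ->
  odd (h j + j) = odd (h i + i).
Proof.
move=> /subnK <-; elim: (j - i) => [//|m IH] st pos.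
have rg : i <= m + i < m.+1 + i by lia.
rewrite -IH => [|k kk|k kk]; [|by apply: st; lia|by apply: pos; lia].
by rewrite addSn; have := pos _ rg; case: (st _ rg) => [->|[->|[-> ->]]]; lia.
Qed.

Section ArcsOfHeight.
Variables (N : nat) (h : nat -> nat).
Hypothesis oN : odd N.
Hypothesis hN : h N = h 0.
Hypothesis hstep : forall x, x < N -> height_step h x.
Local Notation T := 'I_N.+1.
Implicit Types (P Q A X : {set T}) (B C : {set {set T}}) (x y : T).

Definition arcs : {set {set T}} := [set P | is2 P && is_arc h P].

(** Discrete intermediate values: [h] drops by at most 1, so the first gap of height at most [m] has
    height exactly [m]. *)
Lemma first_return k0 k1 m : k0 <= k1 -> k1 <= N -> m < h k0 -> h k1 <= m ->
  exists k, [/\ k0 < k, k <= k1, h k = m & forall j, k0 <= j < k -> m < h j].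
Proof.
move=> k01 k1N hk0 hk1.
have ex : exists k, (k0 <= k) && (h k <= m) by exists k1; rewrite k01.
case: (ex_minnP ex) => k /andP[k0k hk] kmin; exists k.
have lt0 : k0 < k by rewrite ltn_neqAle k0k andbT; apply: contraTneq hk0 => ->; lia.
have lek : k <= k1 by apply: kmin; rewrite k01.
have hj j : k0 <= j < k -> m < h j.
  by move=> /andP[k0j jk]; rewrite ltnNge; apply/negP => le; have := kmin j; lia.
have kE : k.-1.+1 = k by lia.
have h1 : m < h k.-1 by apply: hj; lia.
have := @hstep k.-1; rewrite /height_step kE => /(_ ltac:(lia)) st.
split=> //; lia.
Qed.

Lemma last_departure k0 k1 m : k0 <= k1 -> k1 <= N -> h k0 <= m -> m < h k1 ->
  exists k, [/\ k0 <= k, k < k1, h k = m & forall j, k < j <= k1 -> m < h j].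
Proof.
move=> k01 k1N hk0 hk1.
have ex : exists k, (k <= k1) && (h k <= m) by exists k0; rewrite k01.
have ub k : (k <= k1) && (h k <= m) -> k <= k1 by case/andP.
case: (ex_maxnP ex ub) => k /andP[kk1 hk] kmax; exists k.
have lt1 : k < k1 by rewrite ltn_neqAle kk1 andbT; apply: contraTneq hk1 => <-; lia.
have le0 : k0 <= k by apply: kmax; rewrite k01.
have hj j : k < j <= k1 -> m < h j.
  by move=> /andP[kj jk]; rewrite ltnNge; apply/negP => le; have := kmax j; lia.
have h1 : m < h k.+1 by apply: hj; lia.
have := @hstep k; rewrite /height_step => /(_ ltac:(lia)) st.
split=> //; lia.
Qed.

(** No flat step occurs during an excursion above a level, so its two bounding gaps [i - 1] and [j],
    of equal height, have the same parity. The pair is thus a line. *)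
Lemma chord_line_arc i j : 0 < i -> i < j -> j <= N -> h i.-1 = h j ->
  (forall k, i <= k < j -> h j < h k) -> chord N i j \in arcs /\ line (chord N i j).
Proof.
move=> i0 ij jN hij hgt.
have par := @height_parity h i.-1 j.
have ln : line (chord N i j).
  rewrite /line lo_chord ?hi_chord //.
  have : odd (h j + j) = odd (h i.-1 + i.-1).
    apply: par => [|k kk|k kk]; [lia|apply: hstep; lia|].
    have [->|ne] := eqVneq k i.-1; last by left; have := hgt k; lia.
    by right; have := hgt i; rewrite prednK //; lia.
  by rewrite hij; lia.
split=> //; rewrite inE is2_chord //=; apply/is_arcP.
by rewrite /op /cl /over ln lo_chord ?hi_chord //; split=> // k _ /hgt.
Qed.

(** The excursion runs from gap [i - 1] to N and on from 0 to [j]. Parity is preserved on each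
    piece, and the oddness of N makes [i - j] even. *)
Lemma chord_wrap_arc i j : 0 < j -> j < i -> i <= N -> h i.-1 = h j ->
  (forall k, k <= N -> (k < j) || (i <= k) -> h j < h k) ->
  chord N j i \in arcs /\ ~~ line (chord N j i).
Proof.
move=> j0 ji iN hij hgt.
have nl : ~~ line (chord N j i).
  rewrite /line lo_chord ?hi_chord //.
  have p1 : odd (h N + N) = odd (h i.-1 + i.-1).
    apply: height_parity => [|k kk|k kk]; [lia|apply: hstep; lia|].
    by right; have := hgt k.+1; lia.
  have p2 : odd (h j + j) = odd (h 0 + 0).
    apply: height_parity => [|k kk|k kk]; [lia|apply: hstep; lia|].
    by left; have := hgt k; lia.
  by move: p1 p2; rewrite hN hij; lia.
split=> //; rewrite inE is2_chord //=; apply/is_arcP.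
by rewrite /op /cl /over (negbTE nl) lo_chord ?hi_chord.
Qed.

Lemma arc_at_op (x : nat) : x < N -> h x.+1 = (h x).+1 -> exists2 P, P \in arcs & op P = x.+1.
Proof.
move=> xN hx.
have hS : h x < h x.+1 by rewrite hx.
have [/hasP[k /[!mem_index_iota] kk hk]|/hasPn nk] :=
  boolP (has (fun k => h k <= h x) (index_iota x.+1 N.+1)).
  have [|| j [j1 j2 j3 j4]] := @first_return x.+1 k (h x) _ _ hS hk; [lia..|].
  have [|||||Pa Pl] := @chord_line_arc x.+1 j; rewrite ?j3 //; [lia..|].
  exists (chord N x.+1 j) => //; rewrite /op Pl lo_chord //; lia.
(* Without a return up to N the excursion continues from gap 0, as [h 0 = h N], and reaches its base
   level at gap [x] at the latest. *)
have hgt k : x < k <= N -> h x < h k.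
  by move=> kk; rewrite ltnNge; apply: nk; rewrite mem_index_iota; lia.
have h0 : h x < h 0 by rewrite -hN; apply: hgt; lia.
have [|| j [j1 j2 j3 j4]] := @first_return 0 x (h x) _ _ h0 (leqnn _); [lia..|].
have [|||||Pa Pl] := @chord_wrap_arc x.+1 j; rewrite ?j3 //.
  by move=> k kN kk; case/orP: kk => kk; [apply: j4|apply: hgt]; lia.
exists (chord N j x.+1) => //; rewrite /op (negbTE Pl) hi_chord //; lia.
Qed.

Lemma arc_at_cl (x : nat) : x < N -> h x = (h x.+1).+1 -> exists2 P, P \in arcs & cl P = x.+1.
Proof.
move=> xN hx; set m := h x.+1 in hx *.
have hS : m < h x by rewrite hx.
have [/hasP[k /[!mem_index_iota] kk hk]|/hasPn nk] :=
  boolP (has (fun k => h k <= m) (index_iota 0 x.+1)).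
  have [|| j [j1 j2 j3 j4]] := @last_departure k x m _ _ hk hS; [lia..|].
  have [|||||Pa Pl] := @chord_line_arc j.+1 x.+1; rewrite ?j3 //.
  by exists (chord N j.+1 x.+1) => //; rewrite /cl Pl hi_chord //; lia.
have hgt k : k <= x -> m < h k.
  by move=> kk; rewrite ltnNge; apply: nk; rewrite mem_index_iota; lia.
have h0 : m < h N by rewrite hN; apply: hgt; lia.
have [|| j [j1 j2 j3 j4]] := @last_departure x.+1 N m _ _ (leqnn _) h0; [lia..|].
have [|||||Pa Pl] := @chord_wrap_arc j.+1 x.+1; rewrite ?j3 //.
  by move=> k kN kk; case/orP: kk => kk; [apply: hgt|apply: j4]; lia.
by exists (chord N x.+1 j.+1) => //; rewrite /cl (negbTE Pl) lo_chord //; lia.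
Qed.

(** A common end opens both arcs or closes both, since [h] goes up at an opening and down at a
    closing. *)
Lemma arcs_matching : matching arcs.
Proof.
apply: matchingI => [P|P Q x]; rewrite !inE; first by case/andP.
case/andP=> P2 aP /andP[Q2 aQ].
have := arc_op_step P2 aP; have := arc_op_step Q2 aQ.
have := arc_cl_step P2 aP; have := arc_cl_step Q2 aQ.
rewrite !op_cl_mem // => s1 s2 s3 s4 /orP[] /eqP e /orP[] /eqP e'.
- by apply: (op_arc_inj P2 Q2 aP aQ); rewrite -e -e'.
- by move: s1 s4; rewrite -e -e'; lia.
- by move: s2 s3; rewrite -e -e'; lia.
by apply: (cl_arc_inj P2 Q2 aP aQ); rewrite -e -e'.
Qed.

Lemma arcs_good : good arcs.
Proof.
split=> [|P x]; first exact: arcs_matching.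
rewrite inE => /andP[P2 aP] xP; have [xinP|xnP] := boolP (x \in P).
  by exists P; rewrite inE P2 aP xinP.
have x0 := bra_gt0 P2 xP.
have lexN : x <= N by rewrite -ltnS.
have kx : x.-1.+1 = x by rewrite prednK.
have lxN : x.-1 < N by lia.
have : over P x /\ over P x.-1.
  move: xnP xP; rewrite op_cl_mem // bra_over // negb_or => /andP[/eqP n1 /eqP n2].
  by have := @over_notin _ P x.-1 P2; rewrite kx => -> //; rewrite orbb.
case=> ox oxp; have [eP /[dup] gP hP] := is_arcP _ _ aP.
have hx := gP _ lexN ox; have hxp := gP _ (leq_trans (leq_pred _) lexN) oxp.
have [P0 Plh PN _] := is2P P2.
(* A pair through [x] with a higher base level than [P] is enough: the two gaps bounding [P] are at
   the base level of [P], so they are neither under [Q] nor next to its ends on the outside. *)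
suff [Q [QC xQ Qgt hQ]] : exists Q, [/\ Q \in arcs, x \in Q,
    (forall k, k <= N -> over Q k -> h (cl P) < h k) & h (cl P) < h (cl Q)].
  exists Q; split=> //; have Q2 : is2 Q by move: QC; rewrite inE => /andP[].
  have aQ : is_arc h Q by move: QC; rewrite inE => /andP[].
  have [eQ _] := is_arcP _ _ aQ.
  rewrite bra_subset //; have [Q0 Qlh QN _] := is2P Q2.
  have [oP0 oPN cP0 cPN _] := op_range P2; have [oQ0 oQN cQ0 cQN _] := op_range Q2.
  have n1 : ~~ over Q (op P).-1.
    by apply/negP => /(Qgt _ (leq_trans (leq_pred _) oPN)); rewrite eP ltnn.
  have n2 : ~~ over Q (cl P) by apply/negP => /(Qgt _ cPN); rewrite ltnn.
  have n3 : (op P).-1 <> cl Q by move=> e; move: hQ; rewrite -e eP ltnn.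
  have n4 : (cl P) <> cl Q by move=> e; move: hQ; rewrite -e ltnn.
  have n5 : (op P).-1 <> (op Q).-1 by move=> e; move: hQ; rewrite -eQ -e eP ltnn.
  have n6 : (cl P) <> (op Q).-1 by move=> e; move: hQ; rewrite -eQ -e ltnn.
  move: xQ xnP ox oxp; rewrite !mem_is2 //.
  have lth : ~~ line P -> (lo P).+1 < hi P by rewrite /line; lia.
  have lth' : ~~ line Q -> (lo Q).+1 < hi Q by rewrite /line; lia.
  move: n1 n2 n3 n4 n5 n6 lth lth'; rewrite /subarc /op /cl /over.
  clear gP hP Qgt eP hx hxp hQ eQ hN hstep aP aQ QC.
  by case: (line P); case: (line Q) => /=; lia.
have fin Q : Q \in arcs -> h (cl P) < h (cl Q) ->
  forall k, k <= N -> over Q k -> h (cl P) < h k.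
  rewrite inE => /andP[_ /is_arcP[_ aQ]] lt k kN /(aQ _ kN); exact: ltn_trans.
(* Both gaps at [x] are higher than the base of [P], so the step at [x] is not flat and an arc opens
   or closes there. *)
have := hstep lxN; rewrite /height_step kx => -[hu|[hd|[e1 e2]]]; last by lia.
  have [|Q QC] := @arc_at_op x.-1 lxN; rewrite ?kx // => oQ.
  have /andP[Q2 /is_arcP[eQ _]] : is2 Q && is_arc h Q by move: QC; rewrite inE.
  have hQ : h (cl P) < h (cl Q) by rewrite -eQ oQ.
  by exists Q; split=> //; [rewrite op_cl_mem // oQ eqxx | apply: fin].
have [|Q QC] := @arc_at_cl x.-1 lxN; rewrite ?kx // => oQ.
have /andP[Q2 _] : is2 Q && is_arc h Q by move: QC; rewrite inE.
have hQ : h (cl P) < h (cl Q) by rewrite oQ.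
by exists Q; split=> //; [rewrite op_cl_mem // oQ eqxx orbT | apply: fin].
Qed.

(** Both heights make the same steps, so they differ by a constant; at a point where [h] is flat
    both vanish. *)
Lemma height_arcs k : k <= N -> height arcs k = h k.
Proof.
have mA := arcs_matching; have gA := arcs_good.
have unm (x : nat) : x < N -> (forall P, P \in arcs -> (inord x.+1 : T) \notin P) ->
    [/\ height arcs x = 0, height arcs x.+1 = 0, h x = 0 & h x.+1 = 0].
  move=> xN un; have kE : (inord x.+1 : T) = x.+1 :> nat by rewrite inordK.
  have x0 : 0 < (inord x.+1 : T) by rewrite kE.
  have [e1 e2] := height_unmatched gA x0 un; rewrite kE /= in e1 e2.
  have no P : P \in arcs -> (op P == x.+1) || (cl P == x.+1) -> False.
    move=> PA; have := un P PA; rewrite op_cl_mem ?(matching_is2 mA) // kE.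
    by rewrite ![x.+1 == _]eq_sym => /negbTE ->.
  split=> //; case: (hstep xN) => [hu|[hd|[//]]].
  - by have [Q QA oQ] := arc_at_op xN hu; case: (no Q QA); rewrite oQ eqxx.
  - by have [Q QA oQ] := arc_at_cl xN hd; case: (no Q QA); rewrite oQ eqxx orbT.
  - by have [Q QA oQ] := arc_at_op xN hu; case: (no Q QA); rewrite oQ eqxx.
  by have [Q QA oQ] := arc_at_cl xN hd; case: (no Q QA); rewrite oQ eqxx orbT.
have dk j : j <= N -> height arcs j + h 0 = h j + height arcs 0.
  elim: j => [|j IH] jN; first by rewrite addnC.
  have {}IH := IH (ltnW jN).
  case: (matched_cases mA jN) => [[P PA oP]|[P PA cP]|un].
  - have /andP[P2 aP] : is2 P && is_arc h P by move: PA; rewrite inE.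
    have := arc_op_step P2 aP; rewrite oP (height_op mA PA oP) /=.
    by have := hstep jN; rewrite /height_step; lia.
  - have /andP[P2 aP] : is2 P && is_arc h P by move: PA; rewrite inE.
    have := arc_cl_step P2 aP; rewrite cP /=; have := height_cl mA PA cP.
    by have := hstep jN; rewrite /height_step; lia.
  by have [e1 e2 e3 e4] := unm _ jN un; move: IH; rewrite e1 e2 e3 e4.
suff e0 : height arcs 0 = h 0 by move=> kN; have := dk _ kN; lia.
(* All steps of [h] being +1 or -1 would contradict [h N = h 0], as [N] is odd. *)
have [/existsP[x /eqP hx]|/existsPn nf] := boolP [exists x : 'I_N, (h x).+1 + h x.+1 == 1].
  have [xN|] := boolP (x < N); last by rewrite ltn_ord.
  have := dk _ (ltnW xN); case: (matched_cases mA xN) => [[P PA oP]|[P PA cP]|un].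
  - by have /andP[P2 aP] : is2 P && is_arc h P by [move: PA; rewrite inE];
    have := arc_op_step P2 aP; rewrite oP /=; lia.
  - by have /andP[P2 aP] : is2 P && is_arc h P by [move: PA; rewrite inE];
    have := arc_cl_step P2 aP; rewrite cP /=; lia.
  by have [-> _ -> _] := unm _ xN un.
have := @height_parity h 0 N (leq0n N); rewrite hN addn0 oddD oN => H.
suff : odd (h 0) (+) true = odd (h 0) by case: odd.
apply: H => j jj; first by apply: hstep; lia.
have jN : j < N by lia.
have /= := nf (Ordinal jN); lia.
Qed.

End ArcsOfHeight.

(** * Every even subset is a sum of arcs of a good set *)

Section Surjectivity.
Variable N : nat.
Hypothesis oN : odd N.
Local Notation T := 'I_N.+1.

Lemma arc_sum_EN (C : {set {set T}}) : matching C -> EN (arc_sum C).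
Proof.
move=> mC; apply/andP; split; last first.
  rewrite /arc_sum; apply: odd_card_big_symd => P PC.
  exact: (odd_card_bra oN (matching_is2 mC PC)).
apply/subsetP => x; rewrite in_big_symd => od.
have: [set P in C | x \in bra P] != set0 by apply: contraTneq od => ->; rewrite cards0.
case/set0Pn => P; rewrite inE => /andP[PC /(bra_gt0 (matching_is2 mC PC))].
by rewrite inE.
Qed.

Lemma arc_sum_surj (A : {set T}) : EN A -> exists2 C, good C & arc_sum C = A.
Proof.
case/andP=> AS evA; pose a k := (inord k : T) \in A.
have a0 : a 0 = false.
  by apply/negP => /(subsetP AS); rewrite inE inordK.
have sumA : \sum_(1 <= x < N.+1) a x = #|A|.
  rewrite -[LHS]add0n -[X in X + _]/(nat_of_bool false) -a0 -big_ltn // big_mkord.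
  rewrite -sum1_card [RHS]big_mkcond /=; apply: eq_bigr => x _.
  by rewrite /a inord_val; case: (x \in A).
have [|h hA] := @height_exists N a oN; first by rewrite sumA.
have [hN hst] := hA.
have hstep x : x < N -> height_step h x by move=> xN; case: (hst x xN).
have hC := height_good (arcs_good oN hN hstep).
exists (arcs N h); first exact: arcs_good.
have eh := height_arcs oN hN hstep.
(* The height relation only speaks of the points 1 to N; the point 0 is in no even subset of
   [SN]. *)
apply/setP => x; have [x0|x0] := posnP x.
  have gt0 B : EN B -> (x \in B) = false.
    by case/andP=> /subsetP/(_ x) BS _; apply/negP => /BS; rewrite inE x0.
  by rewrite !gt0 //; [apply/andP|apply: arc_sum_EN; apply: arcs_matching].
have xE : x = inord x.-1.+1 by rewrite prednK // inord_val.
have xN : x.-1 < N by rewrite prednK // -ltnS.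
by rewrite {1}xE (hC.2 _ xN).2 !eh // 1?ltnW // -(hst _ xN).2 /a -xE.
Qed.

End Surjectivity.

(** * Coverings by odd pairs *)

Section Covers.
Variable N : nat.
Local Notation T := 'I_N.+1.
Implicit Types (P Q R A X : {set T}) (B C : {set {set T}}) (x y : T).

(** [endp] and [inb] express membership in a pair and in its arc for natural numbers, so that [lia]
    can decide it. *)
Definition endp P (k : nat) : bool := (k == lo P) || (k == hi P).
Definition inb P (k : nat) : bool :=
  if line P then lo P <= k <= hi P else (k <= lo P) || (hi P <= k).

Lemma endp_range P k : is2 P -> endp P k -> 0 < k <= N.
Proof. by case/is2P=> l0 lh hN _ /orP[] /eqP ->; slia. Qed.

Lemma mem_endp P x : is2 P -> (x \in P) = endp P x.
Proof. exact: mem_is2. Qed.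

Lemma mem_inord P k : is2 P -> endp P k -> (inord k : T) \in P.
Proof.
move=> P2 eP; have /andP[_ kN] := endp_range P2 eP.
by rewrite mem_endp // inordK.
Qed.

Lemma endp_uniq B P Q k : matching B -> P \in B -> Q \in B -> endp P k -> endp Q k -> P = Q.
Proof.
move=> mB PB QB eP eQ.
exact: matching_uniq mB PB QB (mem_inord (matching_is2 mB PB) eP)
  (mem_inord (matching_is2 mB QB) eQ).
Qed.

Lemma endp_neq B P Q : matching B -> P \in B -> Q \in B -> P != Q ->
  [/\ lo P <> lo Q, lo P <> hi Q, hi P <> lo Q & hi P <> hi Q].
Proof.
move=> mB PB QB /eqP nPQ.
by split=> e; apply: nPQ; [apply: (endp_uniq (k := lo P) mB) | apply: (endp_uniq (k := lo P) mB)
  | apply: (endp_uniq (k := hi P) mB) | apply: (endp_uniq (k := hi P) mB)];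
  rewrite // /endp ?e eqxx ?orbT.
Qed.

Lemma in_B0 B P : (P \in B0 B) = (P \in B) && ~~ line P.
Proof. by rewrite inE. Qed.

Lemma in_B1 B P : (P \in B1 B) = (P \in B) && line P.
Proof. by rewrite inE. Qed.

Lemma goodP C : odd N -> matching C ->
  (forall P k, P \in C -> 0 < k <= N -> inb P k ->
     exists Q, [/\ Q \in C, endp Q k & subarc Q P]) <-> good C.
Proof.
move=> oN mC; split=> [H|[_ H] P k PC /andP[k0 kN] kP].
  split=> // P x PC xP; have P2 := matching_is2 mC PC; have x0 := bra_gt0 P2 xP.
  have [||Q [QC eQ sQ]] := H P x PC; first by rewrite x0 -ltnS ltn_ord.
    by move: xP; rewrite in_bra.
  have Q2 := matching_is2 mC QC; exists Q; split=> //; first by rewrite mem_endp.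
  by rewrite bra_subset.
have P2 := matching_is2 mC PC; have kE : (inord k : T) = k :> nat by rewrite inordK.
have [|Q [QC kQ sQ]] := H P (inord k) PC; first by rewrite in_bra // kE.
have Q2 := matching_is2 mC QC; exists Q; split=> //; last by rewrite -bra_subset.
by rewrite mem_endp // kE in kQ.
Qed.

(** A pointwise form of [cov0] that chooses no decomposition into disjoint intervals. The two agree
    once the lines of [B] are covered themselves. *)
Definition icov B (a b : nat) : Prop := forall k, a <= k <= b ->
  exists Q, [/\ Q \in B, line Q, endp Q k, a <= lo Q & hi Q <= b].

Definition lines_covered B : Prop := forall P, P \in B -> line P -> icov B (lo P) (hi P).

Lemma in_seg P k : k <= N -> ((inord k : T) \in seg P) = (lo P <= k <= hi P).
Proof. by move=> kN; rewrite inE inordK. Qed.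

Lemma seg_subset P a b : is2 P -> (seg P \subset itv N a b) = (a <= lo P) && (hi P <= b).
Proof.
case/is2P=> l0 lh hN _; apply/subsetP/andP => [H|[al hb] x]; last by rewrite !inE; slia.
have := H (inord (lo P)); have := H (inord (hi P)).
by rewrite !inE !inordK //; [slia|apply: leq_trans hN; apply: ltnW].
Qed.

(** The end of [Q] inside [P] is an end of some line within [P], and disjointness identifies that
    line with [Q]. *)
Lemma lines_nested B P Q : matching B -> lines_covered B -> P \in B -> Q \in B ->
  line P -> lo P <= lo Q <= hi P -> line Q /\ hi Q <= hi P.
Proof.
move=> mB lB PB QB lP le; have [R [RB lR eR l1 l2]] := lB P PB lP _ le.
by rewrite -(endp_uniq mB RB QB eR) // /endp eqxx.
Qed.

Lemma lines_nestedr B P Q : matching B -> lines_covered B -> P \in B -> Q \in B ->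
  line P -> lo P <= hi Q <= hi P -> line Q /\ lo P <= lo Q.
Proof.
move=> mB lB PB QB lP le; have [R [RB lR eR l1 l2]] := lB P PB lP _ le.
by rewrite -(endp_uniq mB RB QB eR) // /endp eqxx orbT.
Qed.

Lemma cov0_icov B a b : matching B -> lines_covered B -> b <= N ->
  cov0 B (itv N a b) -> icov B a b.
Proof.
move=> mB lB bN /existsP[C /and3P[CB _ /eqP XE]] k kab.
have : (inord k : T) \in itv N a b by rewrite inE inordK //; slia.
rewrite XE => /bigcupP[P PC kP].
have := subsetP CB P PC; rewrite in_B1 => /andP[PB lP].
have : seg P \subset itv N a b by rewrite XE; apply: bigcup_sup.
rewrite seg_subset ?(matching_is2 mB) // => /andP[aP Pb].
have [|Q [QB lQ eQ l1 l2]] := lB P PB lP k; first by rewrite -in_seg //; slia.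
by exists Q; split=> //; slia.
Qed.

(** Induction on the length: the interior of [P] is a union of segments of shorter lines, which are
    covered in turn. *)
Lemma lines_of_cov0 B : matching B ->
  (forall P, P \in B1 B -> cov0 B (itv N (lo P).+1 (hi P).-1)) -> lines_covered B.
Proof.
move=> mB H P; have [n] := ubnP (hi P - lo P); elim: n P => // n IH P ltn PB lP k lek.
have P2 := matching_is2 mB PB; have [l0 lh hN _] := is2P P2.
have [eP|neP] := boolP (endp P k); first by exists P.
have /existsP[C /and3P[CB _ /eqP XE]] : cov0 B (itv N (lo P).+1 (hi P).-1).
  by apply: H; rewrite in_B1 PB.
have : (inord k : T) \in itv N (lo P).+1 (hi P).-1.
  by rewrite inE inordK; move: neP; rewrite /endp; slia.
rewrite XE => /bigcupP[R RC kR].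
have := subsetP CB R RC; rewrite in_B1 => /andP[RB lR].
have : seg R \subset itv N (lo P).+1 (hi P).-1 by rewrite XE; apply: bigcup_sup.
rewrite seg_subset ?(matching_is2 mB) // => /andP[aP Pb].
have [l0' lh' hN' _] := is2P (matching_is2 mB RB).
have kN : k <= N by slia.
have [||Q [QB lQ eQ l1 l2]] := IH R _ RB lR k; [slia|by rewrite -in_seg|].
by exists Q; split=> //; slia.
Qed.

Lemma icov_cov0 B a b : matching B -> lines_covered B -> icov B a b -> cov0 B (itv N a b).
Proof.
move=> mB lB H.
pose inside Q := [&& Q \in B1 B, a <= lo Q & hi Q <= b].
(* The lines inside [[a,b]] whose segments are maximal for inclusion; nesting makes these segments
   disjoint. *)
pose C := [set P | inside P & [forall Q, inside Q ==>
  (lo Q <= lo P) ==> (hi P <= hi Q) ==> (Q == P)]].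
have inC P : P \in C -> inside P by rewrite inE => /andP[].
have maxC P Q : P \in C -> inside Q -> lo Q <= lo P -> hi P <= hi Q -> Q = P.
  rewrite inE => /andP[_ /forallP/(_ Q)] + iQ l1 l2.
  by rewrite iQ l1 l2 => /eqP.
apply/existsP; exists C; apply/and3P; split.
- by apply/subsetP => P /inC /and3P[].
- apply/forall_inP => P PC; apply/forall_inP => Q QC; apply/implyP => nPQ.
  have /and3P[] := inC _ PC; rewrite in_B1 => /andP[PB lP] aP Pb.
  have /and3P[] := inC _ QC; rewrite in_B1 => /andP[QB lQ] aQ Qb.
  rewrite -setI_eq0; apply/eqP/setP => x; rewrite !inE; apply/negP => /andP[xP xQ].
  have [le|lt] := leqP (lo P) (lo Q).
    have [|_ h] := lines_nested mB lB PB QB lP; first by slia.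
    by case/eqP: nPQ; apply: maxC; rewrite // inC.
  have [|_ h] := lines_nested mB lB QB PB lQ; first by slia.
  by case/eqP: nPQ; apply/esym; apply: maxC; rewrite ?inC //; apply: ltnW.
apply/eqP/setP => x; apply/idP/bigcupP => [|[P /inC /and3P[_ aP Pb]]]; last first.
  by rewrite !inE; slia.
rewrite inE => /H [Q [QB lQ eQ aQ Qb]].
have iQ : inside Q && (lo Q <= x <= hi Q).
  have [_ lh _ _] := is2P (matching_is2 mB QB).
  rewrite /inside in_B1 QB lQ aQ Qb /=; move: eQ; rewrite /endp; clear -lh; lia.
(* A longest line over [x] inside [[a,b]] is maximal. *)
case: (@arg_maxnP _ Q (fun Q => inside Q && (lo Q <= x <= hi Q)) (fun Q => hi Q - lo Q) iQ).
move=> P /andP[iP xP] maxP; exists P; last by rewrite inE.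
rewrite inE iP; apply/forallP => R; apply/implyP => iR; apply/implyP => l1; apply/implyP => l2.
have := maxP R; rewrite iR /= => /(_ ltac:(slia)) le.
have /and3P[] := iP; rewrite in_B1 => /andP[/(matching_is2 mB) P2 _] _ _.
have /and3P[] := iR; rewrite in_B1 => /andP[/(matching_is2 mB) R2 _] _ _.
have [_ lh _ _] := is2P P2; have [_ lh' _ _] := is2P R2.
by apply/eqP; apply: is2_inj => //; slia.
Qed.

Lemma icov_cov1 B a u b : matching B -> lines_covered B -> a <= u <= b -> 0 < u <= N ->
  icov B a u.-1 -> icov B u.+1 b -> cov1 B (itv N a b).
Proof.
move=> mB lB aub u0N /(icov_cov0 mB lB) /existsP[C1 /and3P[CB1 /forall_inP d1 /eqP e1]].
move=> /(icov_cov0 mB lB) /existsP[C2 /and3P[CB2 /forall_inP d2 /eqP e2]].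
have uE : (inord u : T) = u :> nat by rewrite inordK; slia.
have cupE : \bigcup_(P in C1 :|: C2) seg P = itv N a u.-1 :|: itv N u.+1 b.
  by rewrite bigcup_setU e1 e2.
have dis P Q : P \in C1 -> Q \in C2 -> [disjoint seg P & seg Q].
  move=> PC QC; rewrite -setI_eq0; apply/eqP/setP => x; rewrite in_setI in_set0.
  apply/negP => /andP[xP xQ].
  have : x \in itv N a u.-1 by rewrite e1; apply/bigcupP; exists P.
  have : x \in itv N u.+1 b by rewrite e2; apply/bigcupP; exists Q.
  by rewrite !inE; slia.
apply/existsP; exists (inord u); apply/existsP; exists (C1 :|: C2); apply/and4P; split.
- by rewrite subUset CB1.
- apply/forall_inP => P; rewrite inE => PC; apply/forall_inP => Q; rewrite inE => QC.
  case/orP: PC => PC; case/orP: QC => QC.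
  + by have /forall_inP/(_ Q QC) := d1 P PC.
  + by rewrite dis ?implybT.
  + by rewrite disjoint_sym dis ?implybT.
  by have /forall_inP/(_ Q QC) := d2 P PC.
- by rewrite cupE !inE uE; slia.
by rewrite cupE; apply/eqP/setP => x; rewrite !inE -val_eqE /= uE; slia.
Qed.

Lemma cov1_icov B a b : matching B -> lines_covered B -> 0 < a -> b <= N ->
  cov1 B (itv N a b) ->
  exists u, [/\ a <= u <= b, icov B a u.-1 & icov B u.+1 b].
Proof.
move=> mB lB a0 bN /existsP[u /existsP[C /and4P[CB dC uC /eqP XE]]].
have ku : a <= u <= b.
  have : u \in itv N a b by rewrite XE !inE eqxx orbT.
  by rewrite inE.
(* A segment of the covering avoids [u], so it lies on one side of [u]. *)
have key k : a <= k <= b -> k <> u -> exists P,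
    [/\ P \in B, line P, lo P <= k <= hi P, a <= lo P <= hi P & (hi P <= b) &&
      ((hi P < u) || (u < lo P))].
  move=> kab nku; have : (inord k : T) \in itv N a b by rewrite inE inordK //; slia.
  have kE : (inord k : T) = k :> nat by rewrite inordK; slia.
  rewrite XE !inE -val_eqE /= kE => /orP[/bigcupP[P PC kP]|/eqP//].
  have := subsetP CB P PC; rewrite in_B1 => /andP[PB lP].
  have P2 := matching_is2 mB PB; have [l0 lh hN _] := is2P P2.
  have : seg P \subset itv N a b by rewrite XE; apply: subsetU; rewrite bigcup_sup.
  rewrite seg_subset // => /andP[aP Pb].
  have : u \notin seg P by apply: contra uC => uP; apply/bigcupP; exists P.
  move: kP; rewrite !inE kE => kP nu; exists P; split=> //; slia.
exists u; split=> //= k kk.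
  have [||P [PB lP kP l1 l2]] := key k; [clear -kk ku a0; lia|clear -kk ku a0; lia|].
  have [Q [QB lQ eQ l3 l4]] := lB P PB lP k kP; by exists Q; split=> //;
    clear -l1 l2 l3 l4 kk kP; lia.
have [||P [PB lP kP l1 l2]] := key k; [clear -kk ku a0; lia|clear -kk ku a0; lia|].
have [Q [QB lQ eQ l3 l4]] := lB P PB lP k kP; by exists Q; split=> //;
  clear -l1 l2 l3 l4 kk kP; lia.
Qed.

Lemma cov0_even B a b : matching B -> 0 < a -> b <= N -> a <= b ->
  cov0 B (itv N a b) -> odd (b - a).
Proof.
move=> mB a0 bN ab /existsP[C /and3P[CB /forall_inP dC /eqP XE]].
apply: negbNE; rewrite -(@odd_card_itv N) // XE.
(* For disjoint segments the union is the sum modulo 2, and a sum of even sets is even. *)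
have -> : \bigcup_(P in C) seg P = \big[@symd N/set0]_(P in C) seg P.
  apply/setP => x; rewrite in_big_symd; apply/bigcupP/idP => [[P PC xP]|od].
    have -> : [set P in C | x \in seg P] = [set P]; last by rewrite cards1.
    apply/setP => Q; rewrite in_set1 [LHS]inE; apply/andP/eqP => [[QC xQ]|-> //].
    apply/eqP; apply: contraTT xQ => nQP; have /forall_inP/(_ _ QC) := dC P PC.
    by rewrite eq_sym nQP /= => /disjointFr/(_ xP) ->.
  have /set0Pn[P] : [set P in C | x \in seg P] != set0.
    by apply: contraTneq od => ->; rewrite cards0.
  by rewrite inE => /andP[]; exists P.
apply: odd_card_big_symd => P PC; have := subsetP CB P PC; rewrite in_B1 => /andP[PB].
by have [l0 lh hN _] := is2P (matching_is2 mB PB); rewrite /line odd_card_itv ?negbK // ltnW.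
Qed.

End Covers.

(** * The structure of *P_N *)

Section Chains.
Variable N : nat.
Local Notation T := 'I_N.+1.
Implicit Types (P Q R A X : {set T}) (B C : {set {set T}}) (x y : T).

Definition wraps_nested B : Prop := forall P Q, P \in B -> Q \in B ->
  ~~ line P -> ~~ line Q -> lo P < lo Q -> hi Q < hi P.

(** Goodness of the wrapping arcs, restricted to the points between the extreme wrapping ends: this
    is what [starP] controls, while the points beyond are the matter of [Xplus] and [Xminus]. *)
Definition wraps_covered B : Prop := forall P k, P \in B -> ~~ line P ->
  i1 B <= k <= i2s B -> inb P k -> exists Q, [/\ Q \in B, endp Q k & subarc Q P].

Lemma ends_wrap B P : matching B -> P \in B -> ~~ line P -> i1 B <= lo P /\ hi P <= i2s B.
Proof.
move=> mB PB lP; have P2 := matching_is2 mB PB; have [l0 lh hN _] := is2P P2.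
have sub x : x \in P -> x \in supp (B0 B).
  by move=> xP; apply/bigcupP; exists P; rewrite // in_B0 PB.
have lN : lo P < N.+1 by rewrite ltnS (leq_trans (ltnW lh)).
split.
  have := @lo_le _ (supp (B0 B)) (inord (lo P)); rewrite inordK //; apply; apply: sub.
  by apply: mem_inord => //; rewrite /endp eqxx.
have := @hi_ge _ (supp (B0 B)) (inord (hi P)); rewrite inordK //; apply; apply: sub.
by apply: mem_inord => //; rewrite /endp eqxx orbT.
Qed.

Lemma ends_outer B P : matching B -> P \in B -> ~~ line P ->
  (forall Q, Q \in B -> ~~ line Q -> lo P <= lo Q /\ hi Q <= hi P) ->
  i1 B = lo P /\ i2s B = hi P.
Proof.
move=> mB PB lP out; have P2 := matching_is2 mB PB; have [l0 lh hN _] := is2P P2.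
have lN : lo P < N.+1 by rewrite ltnS (leq_trans (ltnW lh)).
have lE : (inord (lo P) : T) = lo P :> nat by rewrite inordK.
have hE : (inord (hi P) : T) = hi P :> nat by rewrite inordK.
have sup x : x \in supp (B0 B) -> lo P <= x <= hi P.
  case/bigcupP => Q; rewrite in_B0 => /andP[QB lQ].
  have Q2 := matching_is2 mB QB; have [_ lhQ _ _] := is2P Q2.
  have [l1 l2] := out Q QB lQ; rewrite mem_endp // => /orP[] /eqP ->; slia.
have mem k : endp P k -> (inord k : T) \in supp (B0 B).
  by move=> eP; apply/bigcupP; exists P; [rewrite in_B0 PB|apply: mem_inord].
split.
  rewrite /i1 -lE; apply: lo_eq => [|y /sup]; last by rewrite lE; case/andP.
  by apply: mem; rewrite /endp eqxx.
rewrite /i2s -hE; apply: hi_eq => [|y /sup]; last by rewrite hE; case/andP.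
by apply: mem; rewrite /endp eqxx orbT.
Qed.

(** The point [lo P] is in the arc of [Q], and the only pair through it is [P], so the arc of [P] is
    inside that of [Q]. *)
Lemma wraps_nested_covered B : matching B -> wraps_covered B -> wraps_nested B.
Proof.
move=> mB wB P Q PB QB lP lQ lt.
have [l1 h1] := ends_wrap mB PB lP; have [l2 h2] := ends_wrap mB QB lQ.
have P2 := matching_is2 mB PB; have [l0 lh hN _] := is2P P2.
have [|| R [RB eR]] := wB Q (lo P) QB lQ; first by clear -l1 l2 h1 h2 lh; lia.
  by rewrite /inb (negbTE lQ) ltnW.
rewrite -(endp_uniq mB PB RB _ eR) ?/endp ?eqxx // /subarc (negbTE lP) => /and3P[_ _ le].
have nPQ : P != Q by apply: contraTneq lt => ->; rewrite ltnn.
have [_ _ _] := endp_neq mB PB QB nPQ; clear -le; lia.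
Qed.

Lemma wraps_outer B : matching B -> wraps_nested B -> B0 B != set0 ->
  exists P, [/\ P \in B, ~~ line P, i1 B = lo P & i2s B = hi P].
Proof.
move=> mB nB /set0Pn[P0 P0B].
case: (@arg_minnP _ P0 (fun P => P \in B0 B) (@lo N) P0B) => P.
rewrite in_B0 => /andP[PB lP] minP; exists P.
have [|-> ->] // := @ends_outer B P mB PB lP.
move=> Q QB lQ; have le : lo P <= lo Q by apply: minP; rewrite in_B0 QB.
split=> //; have [->//|nQP] := eqVneq Q P.
have [n1 _ _ _] := endp_neq mB QB PB nQP.
by apply: ltnW; apply: nB => //; clear -le n1; lia.
Qed.

(** These points are in the arc of [Q], so the pairs through them have arcs inside it. Such a pair
    does not wrap, as [P] and [Q] are consecutive, and as a line it cannot pass over an end of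
    [P]. *)
Lemma wraps_gap B P Q : matching B -> lines_covered B -> wraps_covered B ->
  P \in B -> Q \in B -> ~~ line P -> ~~ line Q -> lo P < lo Q ->
  (forall R, R \in B -> ~~ line R -> ~~ (lo P < lo R < lo Q)) ->
  icov B (lo P).+1 (lo Q).-1 /\ icov B (hi Q).+1 (hi P).-1.
Proof.
move=> mB lB wB PB QB lP lQ lt con; have nB := wraps_nested_covered mB wB.
have lt2 := nB _ _ PB QB lP lQ lt.
have [l1 h1] := ends_wrap mB PB lP; have [l2 h2] := ends_wrap mB QB lQ.
have [lP0 lhP hPN _] := is2P (matching_is2 mB PB).
have [lQ0 lhQ hQN _] := is2P (matching_is2 mB QB).
have conh R : R \in B -> ~~ line R -> ~~ (hi Q < hi R < hi P).
  move=> RB lR; apply/negP => /andP[q1 q2]; have /negP := con R RB lR; apply.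
  have [le|lt'] := leqP (lo R) (lo P).
    have nPR : P != R by apply: contraTneq q2 => ->; rewrite ltnn.
    have [n1 _ _ _] := endp_neq mB PB RB nPR.
    by have := nB R P RB PB lR lP; clear -le n1 q2; lia.
  have [le|//] := leqP (lo Q) (lo R).
  have nQR : Q != R by apply: contraTneq q1 => ->; rewrite ltnn.
  have [n1 _ _ _] := endp_neq mB QB RB nQR.
  by have := nB Q R QB RB lQ lR; clear -le n1 q1; lia.
have key k : (lo P < k < lo Q) || (hi Q < k < hi P) -> exists R,
    [/\ R \in B, line R, endp R k & (lo P < lo R) && (hi R < lo Q) || (hi Q < lo R) &&
      (hi R < hi P)].
  move=> kk; have [||R [RB eR sR]] := wB Q k QB lQ.
  - by clear -kk l1 h1 l2 h2 lhQ lhP; lia.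
  - by rewrite /inb (negbTE lQ); clear -kk; lia.
  exists R; have [lR0 lhR hRN _] := is2P (matching_is2 mB RB).
  have [lR|lR] := boolP (line R); last first.
    have := con R RB lR; have := conh R RB lR; move: sR eR;
      rewrite /subarc (negbTE lR) lQ /= /endp.
    by clear -kk lt lt2 lhQ; lia.
  have nRP : R != P by apply: contraNneq lP => <-.
  have nRQ : R != Q by apply: contraNneq lQ => <-.
  have [n1 n2 n3 n4] := endp_neq mB RB PB nRP; have [m1 m2 m3 m4] := endp_neq mB RB QB nRQ.
  split=> //; have out1 : ~~ (lo R <= lo P <= hi R).
    by apply/negP => /(lines_nested mB lB RB PB lR)[]; rewrite (negbTE lP).
  have out2 : ~~ (lo R <= hi P <= hi R).
    by apply/negP => /(lines_nestedr mB lB RB PB lR)[]; rewrite (negbTE lP).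
  move: sR eR; rewrite /subarc lR (negbTE lQ) /endp.
  by clear -kk n1 n2 n3 n4 m1 m2 m3 m4 lhR out1 out2 lt lt2 lhQ lhP; lia.
split=> k kk.
  have [|R [RB lR eR h]] := key k; first by clear -kk lQ0; lia.
  by exists R; split=> //; move: eR; rewrite /endp; clear -h kk lhQ lt2 lQ0 lhP lP0; lia.
have [|R [RB lR eR h]] := key k; first by clear -kk lhP; lia.
by exists R; split=> //; move: eR; rewrite /endp; clear -h kk lhQ lt2 lQ0 lhP lP0; lia.
Qed.

Lemma increasing_locate (f : nat -> nat) p q k : p <= q -> f p <= k <= f q ->
  exists2 m, p <= m <= q & k = f m \/ (m < q /\ f m < k < f m.+1).
Proof.
move=> /subnK <-; elim: (q - p) => [|n IH] le.
  by rewrite add0n in le *; exists p; [slia|left; slia].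
have [le2|lt] := leqP k (f (n + p)).
  have [|m mm h] := IH; first by slia.
  exists m; first by slia.
  by case: h => [->|[h1 h2]]; [left|right; split=> //; slia].
have [->|ne] := eqVneq k (f (n.+1 + p)); first by exists (n.+1 + p); [slia|left].
by exists (n + p); [slia|right; split; [slia|rewrite addSn in le ne *; slia]].
Qed.

Lemma starP_covered B : starP B -> [/\ matching B, lines_covered B & wraps_covered B].
Proof.
case=> mB c1 [sq]; set s := #|B0 B| => -[szq srt allq B0E gaps].
have lB := lines_of_cov0 mB c1; split=> // P k PB lP kk kP.
pose f := nth 0 sq; rewrite -/f in B0E gaps.
have incr i j : i < j -> j < 2 * s -> f i < f j.
  by move=> ij js; apply: (sorted_ltn_nth ltn_trans) => //; rewrite inE szq //;
    apply: ltn_trans js.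
have rg i : i < 2 * s -> 0 < f i <= N by rewrite -szq; apply: (all_nthP 0 allq).
have pairE m : m < s -> [set x : T | (x == f (2 * s - 1 - m) :> nat) || (x == f m :> nat)]
    = chord N (f m) (f (2 * s - 1 - m)).
  by move=> ms; rewrite chordC.
have inB0 m : m < s -> exists Q, [/\ Q \in B, ~~ line Q, lo Q = f m & hi Q = f (2 * s - 1 - m)].
  move=> ms; exists (chord N (f m) (f (2 * s - 1 - m))).
  have lt : f m < f (2 * s - 1 - m) by apply: incr; slia.
  have r1 : 0 < f m <= N by apply: rg; slia.
  have r2 : 0 < f (2 * s - 1 - m) <= N by apply: rg; slia.
  have : chord N (f m) (f (2 * s - 1 - m)) \in B0 B by apply/B0E; exists m; rewrite ?pairE.
  by rewrite in_B0 lo_chord ?hi_chord //; [case/andP|slia..].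
have [m0 m0s [lP0 hP0]] : exists2 m, m < s & lo P = f m /\ hi P = f (2 * s - 1 - m).
  have [|m ms PE] := (B0E P).1; first by rewrite in_B0 PB.
  exists m => //; rewrite PE pairE //.
  have lt : f m < f (2 * s - 1 - m) by apply: incr; slia.
  have r1 : 0 < f m <= N by apply: rg; slia.
  have r2 : 0 < f (2 * s - 1 - m) <= N by apply: rg; slia.
  by rewrite lo_chord ?hi_chord //; slia.
have incl i j : i <= j -> j < 2 * s -> f i <= f j.
  by rewrite leq_eqVlt => /predU1P[->//|ij js]; apply/ltnW/incr.
have [P1 [P1B lP1 loP1 hiP1]] := inB0 0 (leq_ltn_trans (leq0n _) m0s).
have outer Q : Q \in B -> ~~ line Q -> lo P1 <= lo Q /\ hi Q <= hi P1.
  move=> QB lQ; have [|m ms QE] := (B0E Q).1; first by rewrite in_B0 QB.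
  rewrite QE pairE // loP1 hiP1 subn0.
  have lt : f m < f (2 * s - 1 - m) by apply: incr; slia.
  have r1 : 0 < f m <= N by apply: rg; slia.
  have r2 : 0 < f (2 * s - 1 - m) <= N by apply: rg; slia.
  by rewrite lo_chord ?hi_chord //; [split; apply: incl|..]; slia.
have [e1 e2] := ends_outer mB P1B lP1 outer.
(* Positions up to [m0] and from [2 * s - 1 - m0] on are the ends of the wrapping pairs nested
   inside the arc of [P]. *)
have chain m : m < 2 * s -> (m <= m0) || (2 * s - 1 - m0 <= m) ->
    exists Q, [/\ Q \in B, endp Q (f m) & subarc Q P].
  move=> ms; case/orP => mm.
    have [|Q [QB lQ loQ hiQ]] := inB0 m; first by slia.
    exists Q; rewrite /endp loQ eqxx /subarc (negbTE lQ) lP lP0 loQ hP0 hiQ; split=> //=.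
    by rewrite !incl //; slia.
  have [|Q [QB lQ loQ hiQ]] := inB0 (2 * s - 1 - m); first by slia.
  have mE : 2 * s - 1 - (2 * s - 1 - m) = m by slia.
  rewrite mE in hiQ.
  exists Q; rewrite /endp hiQ eqxx orbT /subarc (negbTE lQ) lP lP0 loQ hP0 hiQ; split=> //=.
  by rewrite !incl //; slia.
(* The excluded index [m.+1 = s] is the middle interval, which is outside every wrapping arc. *)
have gap m a b : m.+1 < 2 * s -> a <= m -> m.+1 <= b -> b < 2 * s -> m.+1 != s ->
  f m < k < f m.+1 ->
    (f b <= lo P) || (hi P <= f a) -> exists Q, [/\ Q \in B, endp Q k & subarc Q P].
  move=> ms am mb bs nms kg ab; have := gaps m ms nms.
  have bN : (f m.+1).-1 <= N by have := rg m.+1 ms; slia.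
  move/(cov0_icov mB lB bN) => /(_ k) [|Q [QB lQ eQ lo1 hi1]]; first by slia.
  exists Q; split=> //; rewrite /subarc lQ (negbTE lP).
  have := incl a m am (ltnW ms); have := incl m.+1 b mb bs; clear -ab lo1 hi1 kg; lia.
move: kP kk; rewrite /inb (negbTE lP) e1 e2 loP1 hiP1 lP0 hP0 subn0 => /orP[] ord kk.
  have [||m mm [->|[m1 m2]]] := @increasing_locate f 0 m0 k; [slia|slia| |].
    by apply: chain; slia.
  by apply: (@gap m 0 m0) => //; rewrite ?lP0 ?leqnn //; slia.
have [||m mm [->|[m1 m2]]] := @increasing_locate f (2 * s - 1 - m0) (2 * s - 1) k;
  [slia|slia| |].
  by apply: chain; slia.
by apply: (@gap m (2 * s - 1 - m0) (2 * s - 1)) => //; rewrite ?hP0 ?leqnn ?orbT //; slia.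
Qed.

Lemma covered_starP B : matching B -> lines_covered B -> wraps_covered B -> starP B.
Proof.
move=> mB lB wB; have nB := wraps_nested_covered mB wB; split=> //.
  move=> P; rewrite in_B1 => /andP[PB lP]; apply: icov_cov0 => // k kk.
  have [|Q [QB lQ eQ l1 l2]] := lB P PB lP k; first by clear -kk; lia.
  have nQP : Q != P.
    apply: contraTneq eQ => ->; have [_ lh _ _] := is2P (matching_is2 mB PB).
    by rewrite /endp; clear -kk lh; lia.
  have [n1 n2 n3 n4] := endp_neq mB QB PB nQP.
  by exists Q; split=> //; clear -kk l1 l2 n1 n4; lia.
pose ps := sort (fun P Q => lo P <= lo Q) (enum (B0 B)); set s := #|B0 B|.
have szp : size ps = s by rewrite size_sort -cardE.
have mem_ps P : (P \in ps) = (P \in B0 B) by rewrite mem_sort mem_enum.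
have uniq_ps : uniq ps by rewrite sort_uniq enum_uniq.
pose p := nth set0 ps.
have pB k : k < s -> p k \in B /\ ~~ line (p k).
  by move=> ks; apply/andP; rewrite -in_B0 -mem_ps mem_nth ?szp.
have sps : sorted (fun P Q => lo P <= lo Q) ps.
  by apply: sort_sorted => P Q; apply: leq_total.
have lo_incr i j : i < j -> j < s -> lo (p i) < lo (p j).
  move=> ij js; have is_ : i < s by apply: ltn_trans js.
  have le : lo (p i) <= lo (p j).
    have tr : transitive (fun P Q : {set T} => lo P <= lo Q) by move=> ? ? ?; apply: leq_trans.
    by apply: (sorted_leq_nth tr) => //; rewrite ?inE ?szp // ltnW.
  have [iB _] := pB i is_; have [jB _] := pB j js.
  have nij : p i != p j by rewrite nth_uniq ?szp // ltn_eqF.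
  have [n1 _ _ _] := endp_neq mB iB jB nij; clear -n1 le; lia.
have hi_decr i j : i < j -> j < s -> hi (p j) < hi (p i).
  move=> ij js; have [iB li] := pB i (ltn_trans ij js); have [jB lj] := pB j js.
  exact: nB iB jB li lj (lo_incr i j ij js).
have rg k : k < s -> [/\ 0 < lo (p k), lo (p k) < hi (p k),
  hi (p k) <= N & p k = chord N (lo (p k)) (hi (p k))].
  by move=> /pB[kB _]; apply: is2P; apply: matching_is2 mB kB.
(* By nesting the upper ends decrease while the lower ends increase, hence the reversal. *)
exists (map (@lo N) ps ++ rev (map (@hi N) ps)); set sq := _ ++ _.
have szq : size sq = 2 * s by rewrite size_cat size_rev !size_map szp; slia.
have nth_sq k : k < 2 * s -> nth 0 sq k = if k < s then lo (p k) else hi (p (2 * s - 1 - k)).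
  move=> ks; rewrite nth_cat size_map szp; case: ltnP => kls;
    first by rewrite (nth_map set0) ?szp.
  rewrite nth_rev size_map szp; last by slia.
  by rewrite (nth_map set0) ?szp; [congr (hi (nth _ _ _))|]; slia.
split=> //.
- apply/(sortedP 0) => k; rewrite szq => ks; rewrite !nth_sq //; last by slia.
  case: ltnP => k1; case: ltnP => k2; try (exfalso; slia).
  + exact: lo_incr.
  + have -> : 2 * s - 1 - k.+1 = k by slia.
    by have [] := rg k k1.
  by apply: hi_decr; slia.
- apply/allP => k; rewrite mem_cat mem_rev => /orP[] /mapP[P];
  rewrite mem_ps in_B0 => /andP[PB _] ->;
  have [l0 lh hN _] := is2P (matching_is2 mB PB); slia.
- move=> P; split=> [PB|[k ks PE]].
    exists (index P ps); first by rewrite -szp index_mem mem_ps.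
    have ks : index P ps < s by rewrite -szp index_mem mem_ps.
    have pE : p (index P ps) = P by rewrite /p nth_index // mem_ps.
    move: (index P ps) ks pE => k ks pE.
    have [_ _ _ e] := rg _ ks; rewrite -pE {1}e !nth_sq; [|slia..].
    have -> : 2 * s - 1 - (2 * s - 1 - k) = k by slia.
    rewrite ks ifN; last by slia.
    by rewrite -/(chord N _ _) chordC.
  suff -> : P = p k by rewrite in_B0; apply/andP; apply: pB.
  have [_ _ _ e] := rg _ ks; rewrite {1}e PE !nth_sq; [|slia..].
  have -> : 2 * s - 1 - (2 * s - 1 - k) = k by slia.
  rewrite ks ifN; last by slia.
  by rewrite -/(chord N _ _) chordC.
move=> k ks nks; rewrite !nth_sq //; last by slia.
have con i : i.+1 < s -> forall R, R \in B -> ~~ line R -> ~~ (lo (p i) < lo R < lo (p i.+1)).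
  move=> is_ R RB lR; apply/negP => /andP[q1 q2].
  have RI : R \in ps by rewrite mem_ps in_B0 RB.
  have rE : p (index R ps) = R by rewrite /p nth_index.
  have rs : index R ps < s by rewrite -szp index_mem.
  have [le|lt] := leqP (index R ps) i.
    have [e|ne] := eqVneq (index R ps) i; first by rewrite -rE e ltnn in q1.
    by have := lo_incr (index R ps) i; rewrite rE; clear -le ne q1 is_; lia.
  have [e|ne] := eqVneq (index R ps) i.+1; first by rewrite -rE e ltnn in q2.
  by have := lo_incr i.+1 (index R ps); rewrite rE; clear -lt ne q2 rs; lia.
case: (ltnP k.+1 s) => k1.
  rewrite (ltnW k1); have [aB la] := pB k (ltnW k1); have [bB lb] := pB _ k1.
  have [h _] := wraps_gap mB lB wB aB bB la lb (lo_incr k k.+1 (ltnSn k) k1) (con k k1).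
  exact: icov_cov0.
rewrite ifN; last by slia.
(* In the second half, the interval after position [k] lies between the upper ends of two
   consecutive pairs, read backwards. *)
have jE : 2 * s - 1 - k = (2 * s - 1 - k.+1).+1 by slia.
have j1 : (2 * s - 1 - k.+1).+1 < s by slia.
rewrite jE; move: (2 * s - 1 - k.+1) j1 => j j1.
have [aB la] := pB j (ltnW j1); have [bB lb] := pB _ j1.
have [_ h] := wraps_gap mB lB wB aB bB la lb (lo_incr j j.+1 (ltnSn j) j1) (con j j1).
exact: icov_cov0.
Qed.

End Chains.

(** * From X to good sets of pairs *)

Section Completion.
Variable N : nat.
Local Notation T := 'I_N.+1.
Implicit Types (P Q R K A X : {set T}) (B C : {set {set T}}) (x y : T).

Lemma hi_lt_max B : matching B -> Nmax N \notin supp B -> forall P, P \in B -> hi P < N.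
Proof.
move=> mB nB P PB; have P2 := matching_is2 mB PB; have [l0 lh hN _] := is2P P2.
rewrite ltn_neqAle hN andbT; apply: contra nB => /eqP hE.
by apply/bigcupP; exists P => //; rewrite mem_endp // /endp hE eqxx orbT.
Qed.

Lemma max_in_supp B P : matching B -> P \in B -> hi P = N -> Nmax N \in supp B.
Proof.
move=> mB PB hE; apply/bigcupP; exists P => //.
by rewrite mem_endp ?(matching_is2 mB) // /endp hE eqxx orbT.
Qed.

(** True also for the empty set, where [lo] takes its default value [N.+1]. *)
Lemma pred_lo_le A : (lo A).-1 <= N.
Proof.
have : lo A <= N.+1; last by case: (lo A).
rewrite /lo; elim/big_ind: _ => // [m n|x _]; last exact: ltnW.
by rewrite geq_min => ->.
Qed.

Lemma set2_max (i : T) : [set i; Nmax N] = chord N i N.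
Proof. by apply/setP => x; rewrite !inE -!val_eqE. Qed.

Lemma line_max P : odd N -> is2 P -> hi P = N -> line P = ~~ odd (lo P).
Proof. by move=> oN /is2P[l0 lh hN _] hE; rewrite /line hE oddB ?oN //;
  apply: leq_trans (ltnW lh) _; rewrite hE. Qed.

Lemma card_B0U1 K B : K \notin B -> odd #|B0 (K |: B)| = odd #|B0 B| (+) ~~ line K.
Proof.
move=> KB; have [lK|lK] := boolP (line K).
  rewrite addbF; congr (odd #|pred_of_set _|); apply/setP => P; rewrite !in_B0 in_setU1.
  by case: eqVneq => // ->; rewrite lK !andbF.
have -> : B0 (K |: B) = K |: B0 B.
  apply/setP => P; rewrite in_setU1 !in_B0 in_setU1.
  by case: eqVneq => // ->; rewrite lK.
by rewrite cardsU1 in_B0 (negbTE KB) /= addbT.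
Qed.

Lemma icov_below B a b P k : icov B a b -> a <= k <= b -> ~~ line P ->
  (b <= lo P) || (hi P <= a) -> exists Q, [/\ Q \in B, endp Q k & subarc Q P].
Proof.
move=> H /H[Q [QB lQ eQ aQ Qb]] lP ab; exists Q; split=> //.
by rewrite /subarc lQ (negbTE lP); clear -aQ Qb ab; lia.
Qed.

Lemma lines_covered_arc B P k : lines_covered B -> P \in B -> line P -> inb P k ->
  exists Q, [/\ Q \in B, endp Q k & subarc Q P].
Proof.
move=> lB PB lP; rewrite /inb lP => /(lB P PB lP)[Q [QB lQ eQ l1 l2]].
by exists Q; split=> //; rewrite /subarc lQ lP l1.
Qed.

Hypothesis oN : odd N.

(** Points beyond the extreme wrapping ends lie in all wrapping arcs, and so do the lines that cover
    them. *)
Lemma capped_good B : matching B -> lines_covered B -> wraps_covered B ->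
  (#|B0 B| <> 0 -> icov B 1 (i1 B).-1 /\ icov B (i2s B).+1 N) -> good B.
Proof.
move=> mB lB wB cap; apply/goodP => // P k PB kN kP.
have [lP|lP] := boolP (line P); first exact: lines_covered_arc kP.
have [|c1 c2] := cap.
  by apply/eqP; rewrite -lt0n; apply/card_gt0P; exists P; rewrite in_B0 PB.
have [l1 h1] := ends_wrap mB PB lP.
have [lt|ge] := ltnP k (i1 B).
  by apply: (icov_below c1) => //; clear -lt kN l1; lia.
have [gt|le] := ltnP (i2s B) k.
  by apply: (icov_below c2) => //; clear -gt kN h1; lia.
by apply: wB => //; rewrite ge.
Qed.

(* The two ways to join the point [N] to a free point [u] inside the innermost
   wrapping arc. *)
Definition free_left B u : Prop :=
  [/\ odd u, 0 < u < i1 B, icov B 1 u.-1, icov B u.+1 (i1 B).-1 & icov B (i2s B).+1 N.-1].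
Definition free_right B u : Prop :=
  [/\ ~~ odd u, i2s B < u < N, icov B 1 (i1 B).-1, icov B (i2s B).+1 u.-1 & icov B u.+1 N.-1].

Lemma uB_free B : matching B -> lines_covered B -> wraps_covered B ->
  Nmax N \notin supp B -> odd #|B0 B| -> caseI B \/ caseII B ->
  free_left B (uB B) \/ free_right B (uB B).
Proof.
move=> mB lB wB nB oB cs.
have [|P1 [P1B lP1 e1 e2]] := wraps_outer mB (wraps_nested_covered mB wB).
  by rewrite -card_gt0 odd_gt0.
have [l0 lh _ _] := is2P (matching_is2 mB P1B); have hN := hi_lt_max mB nB P1B.
rewrite -e1 -e2 in l0 lh hN.
rewrite /uB; case c1: (caseI B).
  left; have /andP[/(cov1_icov mB lB)] := c1; case=> [||u [uu i_1 i_2]];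
    [by []|by clear -hN lh; lia|].
  move=> /(cov0_icov mB lB (leq_pred N)) i_3.
  (* The choice in [uB] succeeds because [cov1] supplies a candidate, so its default value 0 never
     occurs. *)
  case: pickP => [v /and3P[vI v1 v2]|/(_ (inord u))] /=; last first.
    have uE : (inord u : T) = u :> nat by rewrite inordK //; clear -uu hN lh; lia.
    by rewrite !inE uE uu !icov_cov0.
  rewrite inE in vI; have vN : v.-1 <= N by clear -vI hN lh; lia.
  split=> //; [|by clear -vI l0; lia|exact: cov0_icov v1|apply: cov0_icov v2 => //;
    clear -hN lh; lia].
  (* The covered interval [[1, v - 1]] has an even number of points, so [v] is odd. *)
  have [v_1|v_1] := leqP v 1; first by have -> : v = 1 :> nat by clear -v_1 vI; lia.
  have := cov0_even mB (ltn0Sn 0) vN _ v1; clear -v_1; lia.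
right; have {cs} /andP[] : caseII B by case: cs => //; rewrite c1.
have i1N : (i1 B).-1 <= N by clear -hN lh; lia.
move=> /(cov0_icov mB lB i1N) i_1 /(cov1_icov mB lB (ltn0Sn _) (leq_pred _))[u [uu i_2 i_3]].
case: pickP => [v /and3P[vI v1 v2]|/(_ (inord u))] /=; last first.
  have uE : (inord u : T) = u :> nat by rewrite inordK //; clear -uu; lia.
  by rewrite !inE uE uu !icov_cov0.
rewrite inE in vI; have vN : v.-1 <= N by clear -vI; lia.
split=> //; [|by clear -vI hN; lia|exact: cov0_icov v1|apply: cov0_icov v2 => //;
  exact: leq_pred].
(* Here [[v + 1, N - 1]] has an even number of points, and N is odd, so [v] is even. *)
have [v_1|v_1] := leqP v.+1 N.-1; last first.
  have -> : v = N.-1 :> nat by clear -v_1 vI; lia.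
  by clear -oN; lia.
have := cov0_even mB (ltn0Sn v) (leq_pred N) v_1 v2; clear -v_1 oN; lia.
Qed.

(** A wrapping pair has its ends between [i1 B] and [i2s B]. A line ending at [u] cannot pass over a
    wrapping end, so its other end is in a covered interval next to [u]; the line would then stay
    inside that interval. *)
Lemma free_notin B u P : matching B -> lines_covered B -> wraps_covered B ->
  Nmax N \notin supp B -> #|B0 B| <> 0 -> free_left B u \/ free_right B u ->
  P \in B -> ~~ endp P u.
Proof.
move=> mB lB wB nB sB fr PB; apply/negP => eP.
have [|P1 [P1B lP1 e1 e2]] := wraps_outer mB (wraps_nested_covered mB wB).
  by rewrite -card_gt0 lt0n; apply/eqP.
have [l0 lh _ _] := is2P (matching_is2 mB PB); have hN := hi_lt_max mB nB PB.
have [lP|lP] := boolP (line P); last first.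
  have [l1 l2] := ends_wrap mB PB lP; move: eP; rewrite /endp.
  by case: fr => -[_ uu _ _ _]; clear -uu l1 l2 lh; lia.
have out1 : ~~ (lo P <= lo P1 <= hi P).
  by apply/negP => /(lines_nested mB lB PB P1B lP)[]; rewrite (negbTE lP1).
have out2 : ~~ (lo P <= hi P1 <= hi P).
  by apply/negP => /(lines_nestedr mB lB PB P1B lP)[]; rewrite (negbTE lP1).
rewrite -e1 in out1; rewrite -e2 in out2.
have no k a b : icov B a b -> a <= k <= b -> endp P k -> a <= lo P /\ hi P <= b.
  move=> H /H[Q [QB lQ eQ aQ Qb]] eP'; by rewrite -(endp_uniq mB QB PB eQ eP').
have elo : endp P (lo P) by rewrite /endp eqxx.
have ehi : endp P (hi P) by rewrite /endp eqxx orbT.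
case/orP: eP => /eqP uE; rewrite uE in fr; case: fr => -[_ uu c1 c2 c3].
- by have [|] := no _ _ _ c2 _ ehi; clear -uu lh l0 hN out1 out2; lia.
- by have [|] := no _ _ _ c3 _ ehi; clear -uu lh l0 hN out1 out2; lia.
- by have [|] := no _ _ _ c1 _ elo; clear -uu lh l0 hN out1 out2; lia.
by have [|] := no _ _ _ c2 _ elo; clear -uu lh l0 hN out1 out2; lia.
Qed.

Lemma free_lt_max B u : matching B -> wraps_covered B -> Nmax N \notin supp B ->
  #|B0 B| <> 0 -> free_left B u \/ free_right B u -> 0 < u < N.
Proof.
move=> mB wB nB sB fr.
have [|P1 [P1B lP1 e1 e2]] := wraps_outer mB (wraps_nested_covered mB wB).
  by rewrite -card_gt0 lt0n; apply/eqP.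
have [l0 lh _ _] := is2P (matching_is2 mB P1B); have hN := hi_lt_max mB nB P1B.
rewrite -e1 -e2 in l0 lh hN; case: fr => -[_ uu _ _ _]; clear -uu l0 lh hN; lia.
Qed.

Lemma free_good B u : matching B -> lines_covered B -> wraps_covered B ->
  Nmax N \notin supp B -> #|B0 B| <> 0 -> free_left B u \/ free_right B u ->
  good (chord N u N |: B).
Proof.
move=> mB lB wB nB sB fr; set K := chord N u N.
have /andP[u0 uN] := free_lt_max mB wB nB sB fr.
have K2 : is2 K by rewrite is2_chord.
have loK : lo K = u by rewrite lo_chord.
have hiK : hi K = N by rewrite hi_chord.
have nu P : P \in B -> ~~ endp P u by exact: free_notin.
have nm P : P \in B -> ~~ endp P N.
  move=> PB; have := hi_lt_max mB nB PB; have [_ lh _ _] := is2P (matching_is2 mB PB).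
  by rewrite /endp; clear -lh; lia.
have eK k : endp K k = (k == u) || (k == N) by rewrite /endp loK hiK.
have KK P : P \in B -> forall x, x \in K -> x \notin P.
  move=> PB x; have P2 := matching_is2 mB PB; rewrite (mem_endp _ K2) (mem_endp _ P2) eK.
  by case/orP => /eqP ->; [apply: nu|apply: nm].
have mK : matching (K |: B).
  apply: matchingI => [P|P Q x]; rewrite !in_setU1;
    first by case/predU1P => [->|/(matching_is2 mB)].
  case/predU1P => [->|PB]; case/predU1P => [->|QB] //.
  - by move=> /(KK _ QB)/negbTE ->.
  - by move=> xP /(KK _ PB); rewrite xP.
  exact: matching_uniq mB PB QB.
have KKB : K \in K |: B by rewrite setU11.
apply/goodP => // P k; rewrite in_setU1 => PKB kN kP.
have up : forall P', (exists Q, [/\ Q \in B, endp Q k & subarc Q P']) ->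
   exists Q, [/\ Q \in K |: B, endp Q k & subarc Q P'].
  by move=> P' [Q [QB eQ sQ]]; exists Q; split=> //; rewrite in_setU1 QB orbT.
have lK : line K = ~~ odd u by rewrite line_max // loK.
have self : endp K k -> exists Q, [/\ Q \in K |: B, endp Q k & subarc Q K].
  by move=> e; exists K; split=> //; rewrite /subarc !leqnn; case: line.
case/predU1P: PKB => [PE|PB].
  rewrite {}PE in kP *; have [/self //|nK] := boolP (endp K k); apply: up.
  move: kP nK; rewrite /inb eK lK loK hiK.
  case: fr => -[ou uu c1 c2 c3] kP nK.
    by rewrite ou /= in lK kP; apply: (icov_below c1); rewrite ?loK ?lK //; clear -kN kP nK;
      lia.
  rewrite ou in lK kP.
  have [|Q [QB lQ eQ l1 l2]] := c3 k; first by clear -kP nK; lia.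
  by exists Q; split=> //; rewrite /subarc lQ lK loK hiK; clear -l1 l2; lia.
have [lP|lP] := boolP (line P); first by apply: up; apply: lines_covered_arc kP.
have [l1 h1] := ends_wrap mB PB lP; have [_ lh hN _] := is2P (matching_is2 mB PB).
(* As [u] is beyond the extreme wrapping ends, the arc of [K] is inside every wrapping arc of
   [B]. *)
have sK : subarc K P.
  rewrite /subarc lK (negbTE lP) loK hiK; case: fr => -[ou uu _ _ _];
    rewrite ?ou ?(negbTE ou) /=;
  by clear -uu l1 h1 hN; lia.
have [eKk|] := boolP (endp K k); first by exists K.
rewrite eK negb_or => /andP[ku kn]; apply: up.
have [/andP[ge le]|] := boolP (i1 B <= k <= i2s B); first by apply: wB; rewrite ?ge.
move=> out; case: fr => -[ou uu c1 c2 c3].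
  have [lt|ge] := ltnP k (i1 B); last first.
    by apply: (icov_below c3) => //; clear -out ge kN kn h1 l1; lia.
  have [lt'|ge] := ltnP k u.
    by apply: (icov_below c1) => //; clear -out lt lt' uu kN kn h1 l1; lia.
  by apply: (icov_below c2) => //; clear -out lt ge uu ku kN kn h1 l1; lia.
have [lt|ge] := ltnP k (i1 B).
  by apply: (icov_below c1) => //; clear -out lt kN kn h1 l1; lia.
have [lt'|ge'] := ltnP k u.
  by apply: (icov_below c2) => //; clear -out ge lt' uu kN kn h1 l1; lia.
by apply: (icov_below c3) => //; clear -out ge ge' uu ku kN kn h1 l1; lia.
Qed.

Definition completion B : {set {set T}} :=
  if (Nmax N \notin supp B) && odd #|B0 B| then chord N (uB B) N |: B else B.

Lemma Xminus_supp B : Xminus B -> Nmax N \in supp B.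
Proof.
case=> _ _ [i [iB _]]; apply/bigcupP; exists [set i; Nmax N] => //.
by rewrite !inE eqxx orbT.
Qed.

Lemma inX_free B : inX B -> Nmax N \notin supp B -> odd #|B0 B| ->
  [/\ matching B, lines_covered B, wraps_covered B & free_left B (uB B) \/ free_right B (uB B)].
Proof.
move=> iX nB oB.
have [/starP_covered[mB lB wB] _ cs] : Xplus B.
  by case: iX => // /Xminus_supp; rewrite (negbTE nB).
split=> //; apply: uB_free => //.
by case: cs => [e|[]//]; rewrite e in oB.
Qed.

Lemma completion_good B : inX B -> good (completion B).
Proof.
move=> iX; rewrite /completion; case: ifP => [/andP[nB oB]|cond].
  have [mB lB wB fr] := inX_free iX nB oB.
  by apply: free_good => // e; rewrite e in oB.
case: iX => [[sP nB cs]|[sP cs _]]; have [mB lB wB] := starP_covered sP;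
  apply: capped_good => // s0.
  by case: cs => [//|[oB _]]; rewrite nB oB in cond.
by case: cs => [//|[_ [c1 c2]]]; split; apply: cov0_icov => //; apply: pred_lo_le.
Qed.

Lemma completion_sum B : inX B -> arc_sum (completion B) = eps' B.
Proof.
move=> iX; rewrite /completion /eps'; case: ifP => // /andP[nB oB].
have [mB lB wB fr] := inX_free iX nB oB.
have sB : #|B0 B| <> 0 by move=> e; rewrite e in oB.
have /andP[u0 uN] := free_lt_max mB wB nB sB fr; set u := uB B in fr u0 uN *.
have KB : chord N u N \notin B.
  apply/negP => /(free_notin mB lB wB nB sB fr).
  by rewrite /endp lo_chord // eqxx.
rewrite /arc_sum big_setU1 //= -/(eps_base B).
have lK : line (chord N u N) = ~~ odd u by rewrite line_max ?is2_chord ?hi_chord ?lo_chord.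
rewrite /bra -/(line _) lK lo_chord ?hi_chord //; case: ifP => _; first by rewrite symdC.
(* The two pieces of the wrapping arc are disjoint because [u < N], so their union is their sum. *)
rewrite -symdA [RHS]symdC; congr symd; apply/setP => x; rewrite in_symd !inE.
by clear -uN; lia.
Qed.

Lemma completion_inj B B' : inX B -> inX B' -> completion B = completion B' -> B = B'.
Proof.
(* An uncompleted set whose supports contains N comes from [Xminus], where the lower end of the pair
   through N has the parity of the number of wrapping pairs; in a completed set these parities
   differ. *)
have mixed D D' : inX D -> inX D' -> (Nmax N \notin supp D) && odd #|B0 D| ->
    ~~ ((Nmax N \notin supp D') && odd #|B0 D'|) -> completion D <> completion D'.
  move=> iD iD' cD cD' eD; have gC := completion_good iD'; rewrite -eD in gC.
  have [nD oD] := andP cD; have [mD lD wD fr] := inX_free iD nD oD.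
  have sD : #|B0 D| <> 0 by move=> e; rewrite e in oD.
  have /andP[u0 uN] := free_lt_max mD wD nD sD fr.
  move: eD gC; rewrite /completion cD (negbTE cD') => eD [mC _].
  set K := chord N (uB D) N in eD mC.
  have hK : hi K = N by rewrite hi_chord.
  have lK : lo K = uB D by rewrite lo_chord.
  have K2 : is2 K by rewrite is2_chord.
  have KC : K \in K |: D by rewrite setU11.
  have sC : Nmax N \in supp D' by rewrite -eD; apply: max_in_supp KC hK.
  case: iD' => [[_ nD' _]|[_ _ [i [iD' io]]]]; first by rewrite sC in nD'.
  have KD : K \notin D.
    by apply/negP => /(hi_lt_max mD nD); rewrite hK ltnn.
  rewrite -eD in iD'.
  have iK : i \in K.
    have nK : Nmax N \in K by rewrite mem_endp // /endp hK eqxx orbT.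
    rewrite -(matching_uniq mC iD' KC _ nK) ?inE ?eqxx ?orbT //.
  have iE : i = uB D :> nat.
    move: iK; rewrite mem_endp // /endp lK hK => /orP[/eqP//|/eqP iN].
    have := matching_is2 mC iD'; have -> : i = Nmax N by apply: val_inj.
    by rewrite setUid /is2 cards1 andbF.
  move: io; rewrite -eD card_B0U1 // oD line_max // lK -iE negbK.
  by case: odd.
move=> iB iB' e.
have [cB|cB] := boolP ((Nmax N \notin supp B) && odd #|B0 B|);
  have [cB'|cB'] := boolP ((Nmax N \notin supp B') && odd #|B0 B'|).
- have [nB oB] := andP cB; have [nB' oB'] := andP cB'.
  have [mB lB wB fr] := inX_free iB nB oB; have [mB' lB' wB' fr'] := inX_free iB' nB' oB'.
  have [mC _] := completion_good iB; move: e mC; rewrite /completion cB cB'.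
  have sB : #|B0 B| <> 0 by move=> e; rewrite e in oB.
  have sB' : #|B0 B'| <> 0 by move=> e; rewrite e in oB'.
  have /andP[u0 uN] := free_lt_max mB wB nB sB fr.
  have /andP[u0' uN'] := free_lt_max mB' wB' nB' sB' fr'.
  (* The added pair is the only one with [hi] equal to N, so discarding such pairs recovers both
     sets. *)
  have D1 D P : matching D -> Nmax N \notin supp D -> (P \in D) = (P \in D) && (hi P != N).
    move=> mD nD; case PD: (P \in D) => //=.
    by rewrite ltn_eqF // (hi_lt_max mD nD PD).
  move=> e _; apply/setP => P; rewrite (D1 B) // (D1 B') //.
  have := congr1 (fun D : {set {set T}} => P \in D) e; rewrite !in_setU1.
  have [hP|hP] := eqVneq (hi P) N; first by rewrite !andbF.
  have -> : (P == chord N (uB B) N) = false by apply: contraNF hP => /eqP ->; rewrite hi_chord.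
  have -> : (P == chord N (uB B') N) = false by apply: contraNF hP => /eqP ->; rewrite hi_chord.
  by rewrite !andbT.
- by case: (mixed B B').
- by case: (mixed B' B).
by move: e; rewrite /completion (negbTE cB) (negbTE cB').
Qed.

End Completion.

(** * From good sets of pairs to X *)

Section Opening.
Variable N : nat.
Hypothesis oN : odd N.
Local Notation T := 'I_N.+1.
Implicit Types (P Q R K A X : {set T}) (B C : {set {set T}}) (x y : T).

(** * Subsets of a good set that miss at most the pair through N *)

Section SubGood.
Variables B C : {set {set T}}.
Hypothesis gC : good C.
Hypothesis sBC : B \subset C.
Hypothesis remB : forall Q, Q \in C -> Q \in B \/
  (Q \notin B /\ hi Q = N /\ forall P, P \in B -> hi P < N).

Let mC : matching C. Proof. by case: gC. Qed.
Let nC : forall P k, P \in C -> 0 < k <= N -> inb P k ->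
  exists Q, [/\ Q \in C, endp Q k & subarc Q P].
Proof. exact/goodP. Qed.
Let BC P : P \in B -> P \in C. Proof. exact: (subsetP sBC). Qed.

Lemma sub_matching : matching B.
Proof.
apply: matchingI => [P /BC|P Q x /BC PC /BC QC]; first exact: matching_is2.
exact: matching_uniq mC PC QC.
Qed.

(** If a pair was removed, the lines of [B] end before N, so the removed pair is under none of
    them. *)
Lemma sub_lines_covered : lines_covered B.
Proof.
move=> P PB lP k kP; have [l0 lh hN _] := is2P (matching_is2 mC (BC PB)).
have [||Q [QC eQ]] := nC (BC PB) (k := k); [by clear -kP l0 hN; lia|by rewrite /inb lP|].
rewrite /subarc lP; case: ifP => [lQ /andP[l1 l2]|_ /and3P[] //].
case: (remB QC) => [QB|[_ [hQ /(_ _ PB) lt]]]; first by exists Q.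
by exfalso; clear -l2 hQ lt; lia.
Qed.

Lemma sub_wraps_nested : wraps_nested B.
Proof.
move=> P Q PB QB lP lQ lt.
have [l0 lh hN _] := is2P (matching_is2 mC (BC PB)).
have [||R [RC eR]] := nC (BC QB) (k := lo P).
- by clear -l0 lh hN; lia.
- by rewrite /inb (negbTE lQ) ltnW.
rewrite -(endp_uniq mC (BC PB) RC _ eR) ?/endp ?eqxx // /subarc (negbTE lP) => /and3P[_ _ le].
have nPQ : P != Q by apply: contraTneq lt => ->; rewrite ltnn.
by have [_ _ _] := endp_neq mC (BC PB) (BC QB) nPQ; clear -le; lia.
Qed.

Lemma sub_wraps_outer : #|B0 B| <> 0 ->
  exists P, [/\ P \in B, ~~ line P, i1 B = lo P & i2s B = hi P].
Proof.
move=> s0; apply: wraps_outer sub_matching sub_wraps_nested _.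
by rewrite -card_gt0 lt0n; apply/eqP.
Qed.

Lemma card_B0_neq0 P : P \in B -> ~~ line P -> #|B0 B| <> 0.
Proof.
by move=> PB lP; apply/eqP; rewrite -lt0n; apply/card_gt0P; exists P; rewrite in_B0 PB.
Qed.

(** The smallest wrapping arc contains N, so by goodness it contains the arc of the pair through N,
    which is the removed one. *)
Lemma sub_removed Q : Q \in C -> Q \notin B -> #|B0 B| <> 0 ->
  if line Q then i2s B < lo Q else lo Q < i1 B.
Proof.
move=> QC nQB s0; have [P1 [P1B lP1 -> ->]] := sub_wraps_outer s0.
case: (remB QC) => [QB|[_ [hQ _]]]; first by rewrite QB in nQB.
have [l0 lh hN _] := is2P (matching_is2 mC QC).
have [||R [RC eR]] := nC (BC P1B) (k := N).
- by clear -l0 lh hN; lia.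
- rewrite /inb (negbTE lP1); have [_ _ h _] := is2P (matching_is2 mC (BC P1B)).
  by rewrite h orbT.
rewrite (endp_uniq mC RC QC eR) ?/endp ?hQ ?eqxx ?orbT //.
have nQP : Q != P1 by apply: contraNneq nQB => ->.
have [n1 n2 n3 n4] := endp_neq mC QC (BC P1B) nQP.
rewrite /subarc (negbTE lP1); have [_ lt h _] := is2P (matching_is2 mC (BC P1B)).
by case: line => /=; clear -n1 n2 n3 n4 lt h hQ; lia.
Qed.

Lemma sub_wraps_covered : wraps_covered B.
Proof.
move=> P k PB lP kk kP; have [l0 lh hN _] := is2P (matching_is2 mC (BC PB)).
have s0 := card_B0_neq0 PB lP.
have [P1 [P1B lP1 e1 e2]] := sub_wraps_outer s0.
have [l0' lh' hN' _] := is2P (matching_is2 mC (BC P1B)).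
have [||Q [QC eQ sQ]] := nC (BC PB) (k := k); [by rewrite e1 e2 in kk; clear -kk l0' hN';
  lia|by []|].
have [QB|nQB] := boolP (Q \in B); first by exists Q.
exfalso; have := sub_removed QC nQB s0.
case: (remB QC) => [QB|[_ [hQ /(_ _ P1B) lt]]]; first by rewrite QB in nQB.
move: eQ kk; rewrite e1 e2 /endp hQ; have [_ lhQ _ _] := is2P (matching_is2 mC QC).
by case: line; clear -lt lhQ lh'; lia.
Qed.

Lemma sub_cap_lo k : #|B0 B| <> 0 -> 0 < k < i1 B -> exists2 Q, Q \in C & endp Q k /\
  (Q \in B -> line Q /\ hi Q < i1 B).
Proof.
move=> s0 kk; have [P1 [P1B lP1 e1 e2]] := sub_wraps_outer s0.
have [l0' lh' hN' _] := is2P (matching_is2 mC (BC P1B)).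
have [||Q [QC eQ sQ]] := nC (BC P1B) (k := k).
- by clear -kk lh' hN' e1; lia.
- by rewrite /inb (negbTE lP1) -e1; clear -kk; lia.
exists Q => //; split=> // QB; have [_ lhQ _ _] := is2P (matching_is2 mC QC).
have [lQ|lQ] := boolP (line Q); last first.
  have [l1 _] := ends_wrap sub_matching QB lQ.
  by exfalso; move: eQ; rewrite /endp; clear -l1 kk lhQ; lia.
have nQP : Q != P1 by apply: contraNneq lP1 => <-.
have [_ _ n _] := endp_neq mC QC (BC P1B) nQP.
split=> //; move: sQ eQ; rewrite /subarc lQ (negbTE lP1) /endp e1.
by rewrite e1 in kk; clear -n kk lhQ lh'; lia.
Qed.

Lemma sub_cap_hi k : #|B0 B| <> 0 -> i2s B < k <= N -> exists2 Q, Q \in C & endp Q k /\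
  (Q \in B -> line Q /\ i2s B < lo Q).
Proof.
move=> s0 kk; have [P1 [P1B lP1 e1 e2]] := sub_wraps_outer s0.
have [l0' lh' hN' _] := is2P (matching_is2 mC (BC P1B)).
have [||Q [QC eQ sQ]] := nC (BC P1B) (k := k).
- by clear -kk lh' hN' e2; lia.
- by rewrite /inb (negbTE lP1) -e2; clear -kk; lia.
exists Q => //; split=> // QB; have [_ lhQ _ _] := is2P (matching_is2 mC QC).
have [lQ|lQ] := boolP (line Q); last first.
  have [_ l1] := ends_wrap sub_matching QB lQ.
  by exfalso; move: eQ; rewrite /endp; clear -l1 kk lhQ; lia.
have nQP : Q != P1 by apply: contraNneq lP1 => <-.
have [_ n _ _] := endp_neq mC QC (BC P1B) nQP.
split=> //; move: sQ eQ; rewrite /subarc lQ (negbTE lP1) /endp e2.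
by rewrite e2 in kk; clear -n kk lhQ lh'; lia.
Qed.

End SubGood.

Lemma completion_surj_kept C : good C ->
  (forall K, K \in C -> hi K = N -> odd (lo K) = odd #|B0 C|) ->
  inX C /\ completion C = C.
Proof.
move=> gC par; have [mC _] := gC.
have rem Q : Q \in C -> Q \in C \/
  (Q \notin C /\ hi Q = N /\ forall P, P \in C -> hi P < N) by left.
have sP : starP C.
  apply: covered_starP => //; first exact: sub_lines_covered gC (subxx C) rem.
  exact: sub_wraps_covered gC (subxx C) rem.
have lC := sub_lines_covered gC (subxx C) rem.
have [|] := boolP (Nmax N \in supp C); last first.
  (* A wrapping arc contains N, and goodness would then provide a pair through N. *)
  move=> nC; have s0 : #|B0 C| = 0.
    apply/eqP; rewrite cards_eq0; apply/eqP/setP => P; rewrite in_B0 in_set0.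
    apply/negP => /andP[PC lP]; case/negP: nC.
    have [_ H] := gC; have [|Q [QC mQ _]] := H P (Nmax N) PC.
      have [_ _ h _] := is2P (matching_is2 mC PC).
      rewrite in_bra ?(matching_is2 mC) //= ?(negbTE lP) ?h ?orbT //.
      by case: (N) oN.
    by apply/bigcupP; exists Q.
  split; last by rewrite /completion s0 andbF.
  by left; split=> //; left.
move=> sN; split; last by rewrite /completion sN.
right; split=> //.
  case: (posnP #|B0 C|) => [->|s0]; [by left|right; split=> //].
  have {}s0 : #|B0 C| <> 0 by move=> e; rewrite e in s0.
  split; apply: icov_cov0 => // k kk.
    have [|Q QC [eQ /(_ QC)[lQ hQ]]] := sub_cap_lo gC (subxx C) s0 (k := k).
      by clear -kk; lia.
    have [l0 lh _ _] := is2P (matching_is2 mC QC).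
    by exists Q; split=> //; clear -hQ l0; lia.
  have [|Q QC [eQ /(_ QC)[lQ hQ]]] := sub_cap_hi gC (subxx C) s0 (k := k).
    by clear -kk; lia.
  have [_ _ hN _] := is2P (matching_is2 mC QC).
  by exists Q; split.
have /bigcupP[K KC] := sN; have K2 := matching_is2 mC KC; have [l0 lh hN KE] := is2P K2.
rewrite mem_endp // /endp /= => eN.
have hK : hi K = N by clear -eN lh hN; lia.
have lE : (inord (lo K) : T) = lo K :> nat by rewrite inordK //; clear -lh hN; lia.
exists (inord (lo K)); rewrite set2_max lE par //; split=> //.
by rewrite [X in chord _ _ X](esym hK) -KE.
Qed.

Lemma completion_surj_removed C K : good C -> K \in C -> hi K = N ->
  odd (lo K) <> odd #|B0 C| ->
  exists2 B, inX B & completion B = C.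
Proof.
move=> gC KC hK par; have [mC _] := gC; have K2 := matching_is2 mC KC.
have [K0 Klh _ KE] := is2P K2; rewrite hK in Klh KE.
have eKN : endp K N by rewrite /endp hK eqxx orbT.
have eKl : endp K (lo K) by rewrite /endp eqxx.
pose B := C :\ K; have CE : K |: B = C by rewrite setD1K.
have KB : K \notin B by rewrite !inE eqxx.
have sBC : B \subset C by apply: subsetDl.
have BN P : P \in B -> hi P < N.
  rewrite !inE => /andP[nPK PC]; have [_ _ h _] := is2P (matching_is2 mC PC).
  rewrite ltn_neqAle h andbT; apply: contra nPK => /eqP hP.
  by apply/eqP; apply: (endp_uniq mC PC KC _ eKN); rewrite /endp hP eqxx orbT.
have CB Q : Q \in C -> Q = K \/ Q \in B.
  by rewrite -CE in_setU1 => /predU1P.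
have rem Q : Q \in C -> Q \in B \/ (Q \notin B /\ hi Q = N /\ forall P, P \in B -> hi P < N).
  by case/CB => [->|]; [right|left].
have mB := sub_matching gC sBC.
have lB := sub_lines_covered gC sBC rem.
have wB := sub_wraps_covered gC sBC rem.
have nB : Nmax N \notin supp B.
  apply/negP => /bigcupP[P PB]; rewrite mem_endp ?(matching_is2 mB) // /endp /=.
  by have := BN P PB; have [_ lh _ _] := is2P (matching_is2 mB PB); clear -lh; lia.
have lK : line K = ~~ odd (lo K) by rewrite line_max.
(* [K] counts in [B0 C] exactly when [lo K] is odd, so the mismatch of parities says that [B] has an
   odd number of wrapping pairs. *)
have oB : odd #|B0 B|.
  by move: par; rewrite -CE card_B0U1 // lK negbK; case: odd; case: odd.
have s0 : #|B0 B| <> 0 by move=> e; rewrite e in oB.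
have Kout := sub_removed gC sBC rem KC KB s0.
have [P1 [P1B lP1 e1 e2]] := sub_wraps_outer gC sBC s0.
have [l0 lh _ _] := is2P (matching_is2 mB P1B); have hP1 := BN P1 P1B.
rewrite -e1 -e2 in l0 lh hP1.
have nK : forall P k, P \in C -> 0 < k <= N -> inb P k ->
  exists Q, [/\ Q \in C, endp Q k & subarc Q P] by exact/goodP.
have endK k : endp K k -> k = lo K \/ k = N.
  by rewrite /endp hK => /orP[] /eqP; [left|right].
(* A line of [B] cannot contain an end of [K], as its arc would contain the point [N]. *)
have Kline Q : Q \in B -> line Q -> ~~ (lo Q <= lo K <= hi Q).
  move=> QB lQ; apply/negP => le.
  have [||R [RC eR sR]] := nK Q (lo K) (subsetP sBC _ QB).
  - by clear -K0 Klh; lia.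
  - by rewrite /inb lQ.
  move: sR; rewrite (endp_uniq mC RC KC eR eKl) /subarc lQ hK.
  by have := BN Q QB; case: line => /=; clear; lia.
have cap_lo k : 0 < k < i1 B -> k <> lo K ->
    exists Q, [/\ Q \in B, line Q, endp Q k, 0 < lo Q & hi Q < i1 B].
  move=> kk kK; have [Q QC [eQ QQ]] := sub_cap_lo gC sBC s0 kk.
  case: (CB _ QC) => [QE|QB].
    by move: eQ; rewrite QE => /endK[]; clear -kk kK lh hP1; lia.
  have [lQ hQ] := QQ QB; have [lQ0 _ _ _] := is2P (matching_is2 mB QB).
  by exists Q.
have cap_hi k : i2s B < k < N -> k <> lo K ->
    exists Q, [/\ Q \in B, line Q, endp Q k, i2s B < lo Q & hi Q < N].
  move=> kk kK; have [|Q QC [eQ QQ]] := @sub_cap_hi _ _ gC sBC k s0; first by clear -kk; lia.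
  case: (CB _ QC) => [QE|QB].
    by move: eQ; rewrite QE => /endK[]; clear -kk kK; lia.
  by have [lQ hQ] := QQ QB; exists Q; split=> //; apply: BN.
have inner k : inb K k -> 0 < k < N -> k <> lo K ->
    exists Q, [/\ Q \in B, endp Q k & subarc Q K].
  move=> iK kk kK; have [||Q [QC eQ sQ]] := nK K k KC; [by clear -kk; lia|by []|].
  case: (CB _ QC) => [QE|QB]; last by exists Q.
  by move: eQ; rewrite QE => /endK[]; clear -kk kK; lia.
have fr : free_left B (lo K) \/ free_right B (lo K).
  have [oK|oK] := boolP (odd (lo K)); [left|right]; rewrite lK ?oK /= in Kout.
    split=> //; first by rewrite K0.
    - move=> k kk; have [|||Q [QB eQ sQ]] := inner k.
      + by rewrite /inb lK oK /=; clear -kk; lia.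
      + by clear -kk Klh; lia.
      + by clear -kk K0; lia.
      have [lQ|lQ] := boolP (line Q); last first.
        have [h1 h2] := ends_wrap mB QB lQ; exfalso.
        by move: sQ; rewrite /subarc (negbTE lQ) => /and3P[_ + _]; clear -h1 Kout; lia.
      have [lQ0 lQh _ _] := is2P (matching_is2 mB QB); exists Q; split=> //.
      have := Kline Q QB lQ; move: sQ; rewrite /subarc lQ lK oK hK /=; have := BN Q QB.
      by clear -lQ0 lQh; lia.
    - move=> k kk; have [||Q [QB lQ eQ q0 q1]] := cap_lo k; [by clear -kk; lia|by clear -kk;
      lia|].
      exists Q; split=> //; last by clear -q1; lia.
      have := Kline Q QB lQ; have [_ lQh _ _] := is2P (matching_is2 mB QB).
      by move: eQ; rewrite /endp; clear -lQh kk; lia.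
    move=> k kk; have [||Q [QB lQ eQ q0 q1]] := cap_hi k.
    - by clear -kk hP1; lia.
    - by clear -kk Kout lh; lia.
    by exists Q; split=> //; clear -q1; lia.
  split=> //.
  - by rewrite Kout.
  - move=> k kk; have [||Q [QB lQ eQ q0 q1]] := cap_lo k.
    + by clear -kk; lia.
    + by clear -kk Kout lh; lia.
    by exists Q; split=> //; clear -q1; lia.
  - move=> k kk; have [||Q [QB lQ eQ q0 q1]] := cap_hi k; [by clear -kk Klh;
    lia|by clear -kk Kout; lia|].
    exists Q; split=> //.
    have := Kline Q QB lQ; have [_ lQh _ _] := is2P (matching_is2 mB QB).
    by move: eQ; rewrite /endp; clear -lQh kk Kout; lia.
  move=> k kk; have [|||Q [QB eQ sQ]] := inner k.
  - by rewrite /inb lK oK hK /=; clear -kk; lia.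
  - by clear -kk Klh K0; lia.
  - by clear -kk; lia.
  move: sQ; rewrite /subarc lK oK /=; case: ifP => // lQ sQ; exists Q; split=> //.
    by have := Kline Q QB lQ; have := is2P (matching_is2 mB QB) => -[_ + _ _]; clear -sQ; lia.
  by have := BN Q QB; clear; lia.
have iX : Xplus B.
  split=> //; first exact: covered_starP.
  right; split=> //; have i1N := pred_lo_le (supp (B0 B)); rewrite -/(i1 B) in i1N.
  case: fr => -[_ uu c1 c2 c3]; [left|right]; apply/andP; split; try exact: icov_cov0.
    by apply: (icov_cov1 mB lB _ _ c1 c2); clear -uu i1N Klh; lia.
  by apply: (icov_cov1 mB lB _ _ c2 c3); clear -uu Klh; lia.
exists B; first by left.
rewrite /completion nB oB /= -CE; congr (_ |: _).
(* The free point is unique: [lo K] is an end of no pair of [B], so it avoids the covered intervals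
   around [uB B], and it is beyond the extreme wrapping ends; only [uB B] itself remains. *)
suff -> : uB B = lo K by [].
have [_ _ [e|[_ cs]]] := iX; first by rewrite e in s0.
have no Q : Q \in B -> ~~ endp Q (lo K).
  move=> QB; apply/negP => eQ.
  by move: KB; rewrite -(endp_uniq mC (subsetP sBC _ QB) KC eQ eKl) QB.
have out : (lo K < i1 B) || (i2s B < lo K).
  by move: Kout; case: line => ->; rewrite ?orbT.
have nocov a b : icov B a b -> ~~ (a <= lo K <= b).
  by move=> H; apply/negP => /H[Q [QB _ eQ _ _]]; move: (no Q QB); rewrite eQ.
case: (uB_free oN mB lB wB nB oB cs) => -[_ uu /nocov n1 /nocov n2 /nocov n3].
  by clear -n1 n2 n3 uu out K0 Klh; lia.
by clear -n1 n2 n3 uu out K0 Klh; lia.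
Qed.

Lemma completion_surj C : good C -> exists2 B, inX B & completion B = C.
Proof.
move=> gC.
have [/exists_inP[K KC /andP[/eqP hK /eqP par]]|/exists_inPn H] :=
    boolP [exists K in C, (hi K == N) && (odd (lo K) != odd #|B0 C| :> bool)].
  exact: completion_surj_removed gC KC hK par.
have [|iC eC] := completion_surj_kept gC; last by exists C.
by move=> K KC hK; have := H K KC; rewrite hK eqxx /= negbK => /eqP.
Qed.

End Opening.

Theorem theorem2p9 (N : nat) (HNodd : odd N) (HN3 : 3 <= N) :
  [/\ (forall B : {set {set 'I_N.+1}}, inX B -> EN (eps' B)),
      (forall B B' : {set {set 'I_N.+1}}, inX B -> inX B' ->
          eps' B = eps' B' -> B = B') &
      (forall A : {set 'I_N.+1}, EN A ->
          exists B : {set {set 'I_N.+1}}, inX B /\ eps' B = A)].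
Proof.
split=> [B iB|B B' iB iB' e|A EA].
- rewrite -completion_sum //; apply: arc_sum_EN => //.
  by have [] := completion_good HNodd iB.
- apply: (completion_inj HNodd) => //; apply: (arc_sum_inj HNodd).
  + exact: completion_good.
  + exact: completion_good.
  by rewrite !completion_sum.
have [C gC <-] := arc_sum_surj HNodd EA.
have [B iB <-] := completion_surj HNodd gC.
by exists B; rewrite completion_sum.
Qed.
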